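(* Let $S=S_1\cup\cdots\cup S_k\subset\mathbb{P}^3$ be a cycle of quadrics with $k\ge3$, with edge conics $C_1,\dots,C_k$ and poles $v_1,v_2$. There is a unique surface $A_S\subset\mathbb{P}^3$ of degree $2k-4$ that contains the residual singularities $R(S)$ of $S$ and none of the edge conics $C_1,\dots,C_k$. When $k>3$, the surface $A_S$ passes through the poles of the cycle.
   Context: Work in complex projective space $\mathbb{P}^3$. Let $v_1,v_2\in\mathbb{P}^3$ be two points and let $S=S_1\cup\cdots\cup S_k$, $k\ge3$, be a union of nonsingular quadric surfaces whose common intersection $S_1\cap\dots\cap S_k$ includes $v_1,v_2$ when $k=3$ and equals $\{v_1,v_2\}$ when $k>3$. Assume there are $k$ edge conics $C_1,\dots,C_k$ (nonsingular conics) passing through $v_1$ and $v_2$ such that $C_i\subset S_i\cap S_{i+1}$ for $i=1,\dots,k-1$ and $C_k\subset S_k\cap S_1$. Assume moreover that the singularities of $S$ are double points along transverse intersections of pairs of components $S_i,S_j$, ordinary triple points between triples of components, plus the two ordinary $k$-tuple points $v_1,v_2$. Then $S$ is called a cycle of quadrics and $v_1,v_2$ its poles. The residual singularities are the part of the singular locus of $S$ residual to the edge conics, i.e. the union of pairwise intersection curves $R(S)=\bigcup_{i\ne j}\bigl((S_i\cap S_j)\setminus(C_1\cup\cdots\cup C_k)\bigr)$. *)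

(* Defs.v *)
From mathcomp Require Import all_boot all_order all_algebra.
From mathcomp Require Import complex.
From mathcomp Require Import classical_sets cardinality reals.
From mathcomp Require Import mpoly.

Set Implicit Arguments.
Unset Strict Implicit.
Unset Printing Implicit Defensive.

Import GRing.Theory.
Local Open Scope classical_set_scope.
Local Open Scope ring_scope.

Section Projective3Space.
Variable K : fieldType.
Implicit Types p q l : {mpoly K[4]}.

(* The points of the projective 3-space over K are the lines of K^4. *)
Definition P3 : Type := {V : {vspace 'rV[K]_4} | \dim V == 1%N}.

(* [vpick V] is a nonzero vector of V, so this is one choice of homogeneous
   coordinates of x. The notions below are only used for homogeneous
   polynomials, for which they do not depend on this choice. *)
Definition hcoord (x : P3) : 'I_4 -> K := fun j => vpick (val x) 0 j.

Definition zeros p : set P3 := [set x | p.@[hcoord x] = 0].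

Definition gradient p (x : P3) : 'rV[K]_4 := \row_j (p^`M(j)).@[hcoord x].

(* A surface of degree d is an effective divisor, i.e. a nonzero form of
   degree d considered up to a nonzero scalar. *)
Definition surface (d : nat) p := p != 0 /\ p \is d.-homog.

Definition nonsingular_quadric q :=
  surface 2 q /\ forall x, zeros q x -> gradient q x != 0.

Definition transverse_at p q (x : P3) := free [:: gradient p x; gradient q x].

(* A conic is cut out on a plane l = 0 by a quadric q = 0; it is nonsingular
   when this complete intersection satisfies the Jacobian criterion. *)
Definition nonsingular_conic (C : set P3) :=
  exists l q, [/\ surface 1 l, surface 2 q, C = zeros l `&` zeros q &
    forall x, C x -> transverse_at l q x].

(* Two surfaces are (generically) transverse when their tangent planes are
   distinct at all but finitely many of their common points: every component of
   the intersection is then a reduced curve. Transversality at every common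
   point would be too strong here: if two quadrics share a conic, they meet
   residually in a second conic and are tangent where the two conics meet. *)
Definition generically_transverse p q :=
  finite_set [set x | [/\ zeros p x, zeros q x & ~~ transverse_at p q x]].

Section Cycle.
Variables (k : nat) (S : 'I_k -> {mpoly K[4]}).

Definition sheets (x : P3) : pred 'I_k := [pred i | (S i).@[hcoord x] == 0].

(* The tangent planes of the sheets through x are in general position. *)
Definition ordinary_point (x : P3) :=
  forall i j m, i \in sheets x -> j \in sheets x -> m \in sheets x ->
    uniq [:: i; j; m] ->
    free [:: gradient (S i) x; gradient (S j) x; gradient (S m) x].

(* Indices are cyclic: [ordS i] is the successor of i modulo k. *)
Record cycle_of_quadrics (C : 'I_k -> set P3) (v1 v2 : P3) : Prop := {
  cq_poles_distinct : v1 <> v2;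
  cq_quadrics : forall i, nonsingular_quadric (S i);
  cq_common : [set v1; v2] `<=` \bigcap_(i in [set: 'I_k]) zeros (S i);
  cq_common_eq :
    (3 < k)%N -> \bigcap_(i in [set: 'I_k]) zeros (S i) = [set v1; v2];
  cq_conics : forall i, nonsingular_conic (C i);
  cq_conics_poles : forall i, C i v1 /\ C i v2;
  cq_edges : forall i, C i `<=` zeros (S i) `&` zeros (S (ordS i));
  cq_double : forall i j, i != j -> generically_transverse (S i) (S j);
  cq_triple : forall x, x <> v1 -> x <> v2 ->
    (#|sheets x| <= 2)%N \/ #|sheets x| = 3%N /\ ordinary_point x;
  cq_poles : ordinary_point v1 /\ ordinary_point v2
}.

Definition residual (C : 'I_k -> set P3) : set P3 :=
  [set x | (exists i j, [/\ i != j, zeros (S i) x & zeros (S j) x]) /\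
           ~ (exists i, C i x)].

Definition adjoint_surface (C : 'I_k -> set P3) (A : {mpoly K[4]}) :=
  [/\ surface (2 * k - 4)%N A, residual C `<=` zeros A &
      forall i, ~ (C i `<=` zeros A)].

End Cycle.
End Projective3Space.

(* Main.v *)
(** Normalise the quadrics so that their polar forms take the value 1 on the two
    poles.  The edge conic [C_i] lies in a plane [l_i = 0] through both poles and
    [Q_(i+1) - Q_i = l_i m_i], where [m_i = 0] is the plane of the conic residual
    to [C_i].  All [l_i] are combinations [s_i z + t_i w] of two linear forms, and
    with [P_i] the product of the [Q_j], [j] different from [i] and [i+1], the sum
    of the [l_i m_i P_i] telescopes to 0 around the cycle.  Hence [z] divides the
    sum of the [t_i m_i P_i]; the quotient [A] is the adjoint.

    On [Q_i = 0] the residual curves are cut out by a form [F_i] of degree exactly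
    [2k - 4], the product of [m_i], [m_(i-1)] and of the [Q_j] with [j] not in
    [{i-1, i, i+1}].  Restrict [F_i] to a chart [K^2] of the quadric.  If it were
    not squarefree, two of its factors would be tangent, or one of them singular,
    at infinitely many points, against transversality and the ordinary triple
    points.  So a generic line of the chart meets the residual curve in the full
    number of distinct points, and every form of degree [2k - 4] vanishing there
    is a multiple of [F_i] modulo [Q_i].  Evaluating on the edge conics, the
    proportionality factors of two adjoints agree from one quadric to the next;
    a combination of them is then divisible by all the [Q_i], so it is zero. *)

From mathcomp Require Import all_boot all_order all_algebra.
From mathcomp Require Import polyXY separable complex.
From mathcomp Require Import boolp classical_sets cardinality reals.
From mathcomp Require Import zify ring.
From mathcomp Require Import mpoly.
Require Import Defs.
Set Implicit Arguments.
Unset Strict Implicit.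
Unset Printing Implicit Defensive.
Import GRing.Theory Num.Theory.
Local Open Scope ring_scope.

Local Notation "p .[ x , y ]" := (p.[x%:P].[y])
  (at level 1, left associativity, format "p .[ x ,  y ]") : ring_scope.

(** * Univariate polynomials over a closed field *)

Lemma nonroot_notin (K : closedFieldType) (p : {poly K}) (T : seq K) :
  p != 0 -> exists2 t, t \notin T & p.[t] != 0.
Proof.
move=> p0; have /closed_nonrootP[t] : p * \prod_(x <- T) ('X - x%:P) != 0.
  by rewrite mulf_neq0 // monic_neq0 // monic_prod_XsubC.
by rewrite rootM root_prod_XsubC negb_or => /andP[pt tT]; exists t.
Qed.

(** Over a closed field a separable [f] has as many distinct roots as its degree, too many for a
    nonzero [h] of smaller size. *)
Lemma separable_roots_eq0 (K : closedFieldType) (f h : {poly K}) :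
    separable_poly f -> (size h < size f)%N ->
    (forall s, f.[s] = 0 -> h.[s] = 0) -> h = 0.
Proof.
move=> sepf hf fh; apply/eqP/negPn/negP => h0.
have [r Er] := closed_field_poly_normal f.
have lf0 : lead_coef f != 0 by rewrite lead_coef_eq0 separable_poly_neq0.
have ur : uniq r.
  by rewrite -separable_prod_XsubC -(eqp_separable (eqp_scale _ lf0)) -Er.
have: all (root h) r.
  apply/allP => s sr; apply/eqP/fh/eqP; rewrite -/(root _ _) Er.
  by rewrite rootZ // root_prod_XsubC.
move/(max_poly_roots h0)/(_ ur); rewrite ltnNge.
have : size f = (size r).+1 by rewrite {1}Er size_scale // size_prod_XsubC.
by move=> sfr; rewrite -ltnS -sfr hf.
Qed.

(** * Bivariate polynomials *)

Section BivariatePolynomials.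
Variable K : numClosedFieldType.
Implicit Types (f g h p : {poly {poly K}}) (T : seq K).

(* In {poly {poly K}} the outer variable is the first one, in which [deriv]
   differentiates; [derivY] is the other partial derivative. *)
Definition derivY p : {poly {poly K}} := swapXY (swapXY p)^`().

Lemma derivYC (r : {poly K}) : derivY r%:P = (r^`())%:P.
Proof. by rewrite /derivY swapXY_polyC deriv_map swapXY_map_polyC. Qed.

Lemma derivYD (f g : {poly {poly K}}) : derivY (f + g) = derivY f + derivY g.
Proof. by rewrite /derivY !rmorphD /= derivD rmorphD. Qed.

Lemma derivYN (f : {poly {poly K}}) : derivY (- f) = - derivY f.
Proof. by rewrite /derivY [swapXY (- f)]raddfN derivN [swapXY (- _)]raddfN. Qed.

Lemma derivYX : derivY ('X : {poly {poly K}}) = 0.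
Proof. by rewrite /derivY swapXY_X derivC rmorph0. Qed.

Lemma derivYM p g : derivY (p * g) = derivY p * g + p * derivY g.
Proof. by rewrite /derivY rmorphM derivM rmorphD !rmorphM /= !swapXYK. Qed.

Lemma derivYZ (c : {poly K}) p : derivY (c *: p) = c^`() *: p + c *: derivY p.
Proof. by rewrite -!mul_polyC derivYM /derivY swapXY_polyC deriv_map swapXY_map_polyC. Qed.

Lemma horner2_map_poly p s t : (map_poly (horner_eval t) p).[s] = p.[s, t].
Proof. by rewrite -horner_swapXY horner2_swapXY. Qed.

Lemma horner2_eq0 p : (forall s t, p.[s, t] = 0) -> p = 0.
Proof.
move=> p0; apply/eqP/negPn/negP; rewrite -lead_coef_eq0 => /closed_nonrootP[t lt].
have /closed_nonrootP[s] : map_poly (horner_eval t) p != 0.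
  by rewrite -size_poly_eq0 size_map_poly_id0 // size_poly_eq0 -lead_coef_eq0;
     apply: contraNneq lt => ->; rewrite root0.
by rewrite /root horner2_map_poly p0 eqxx.
Qed.

Lemma horner2Z (c : {poly K}) p s t : (c *: p).[s, t] = c.[t] * p.[s, t].
Proof. by rewrite !hornerE. Qed.

(** Where the leading coefficient survives, specialising the inner variable keeps the degree of [g],
    so there is a root. The list [T] and the zeros of [c] are values of [t] to be avoided. *)
Lemma nonconstant_zero g (c : {poly K}) T :
    (1 < size g)%N -> c != 0 ->
  exists s t, [/\ t \notin T, c.[t] != 0 & g.[s, t] = 0].
Proof.
move=> g1 c0; have g0 : g != 0 by rewrite -size_poly_eq0 -lt0n ltnW.
have cl0 : c * lead_coef g != 0 by rewrite mulf_neq0 ?lead_coef_eq0.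
have [t tT] := nonroot_notin T cl0.
rewrite hornerM mulf_eq0 negb_or => /andP[ct lt].
have /closed_rootP[s] : size (map_poly (horner_eval t) g) != 1.
  by rewrite size_map_poly_id0 // neq_ltn g1 orbT.
by rewrite /root horner2_map_poly => /eqP gst; exists s, t.
Qed.

Lemma deriv_neq0 p : (1 < size p)%N -> p^`() != 0.
Proof.
case E: (size p) => [|[|n]] // _; apply/eqP => /(congr1 (coefp n)).
rewrite /= coef_deriv coef0 => /eqP; rewrite -scaler_nat scaler_eq0 pnatr_eq0 /=.
by rewrite -[n.+1]/(n.+2.-1) -E -lead_coefE lead_coef_eq0 -size_poly_eq0 E.
Qed.

(* A square factor g ^+ 2 of f vanishes for almost every value of the second
   variable, and both partial derivatives of f vanish with it. *)
Lemma nonseparable_singular f T : f != 0 -> ~~ separable_poly f ->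
  exists s t, [/\ t \notin T, f.[s, t] = 0, f^`().[s, t] = 0 &
                  (derivY f).[s, t] = 0].
Proof.
move=> f0 nsep; have [g g1 g2f] : exists2 g : {poly {poly K}}, (1 < size g)%N & g ^+ 2 %| f.
  apply: contrapT => nog; move/negP: nsep; apply; apply/separable_polyP.
  split; last by move=> *; apply: deriv_neq0.
  apply/poly_square_freeP => u u1; apply/negP => u2f; apply: nog; exists u => //.
  have : u != 0.
    by apply: contraTneq u2f => ->; rewrite expr0n dvd0p.
  by rewrite -size_poly_gt0; case: (size u) u1 => [|[]].
(* Divisibility in [{poly {poly K}}] holds up to a nonzero factor [c] from the coefficient ring,
   which must not vanish at the chosen [t]. *)
have /Pdiv.WeakIdomain.dvdpP[[c q] /= c0 cfE] := g2f.
have [s [t [tT ct gst]]] := nonconstant_zero T g1 c0.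
exists s, t; split=> //; apply: (mulfI ct); rewrite mulr0.
- by rewrite -horner2Z cfE expr2 !hornerM gst !mulr0.
- rewrite -horner2Z -derivZ cfE expr2 !derivM !(hornerD, hornerM) gst; ring.
- have fst : f.[s, t] = 0.
    by apply: (mulfI ct); rewrite mulr0 -horner2Z cfE expr2 !hornerM gst !mulr0.
  (* Differentiating in the inner variable also hits [c], but that term carries [f] and vanishes at
     the point. *)
  have : (derivY (c *: f)).[s, t] = 0.
    by rewrite cfE expr2 !derivYM !(hornerD, hornerM) gst; ring.
  by rewrite derivYZ hornerD hornerD !horner2Z fst mulr0 add0r.
Qed.

(* Where a common factor d of f and g vanishes, both gradients are multiples of
   that of d. *)
Lemma noncoprime_singular f g T : f != 0 -> g != 0 -> ~~ coprimep f g ->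
  exists s t, [/\ t \notin T, f.[s, t] = 0, g.[s, t] = 0 &
    f^`().[s, t] * (derivY g).[s, t] = (derivY f).[s, t] * g^`().[s, t]].
Proof.
move=> f0 g0; rewrite /coprimep => ncop; set d := gcdp f g in ncop.
have d1 : (1 < size d)%N.
  have : d != 0 by rewrite gcdp_eq0 negb_and f0.
  by rewrite -size_poly_gt0; case: (size d) ncop => [|[]].
have /Pdiv.WeakIdomain.dvdpP[[a u] /= a0 afE] : d %| f by rewrite dvdp_gcdl.
have /Pdiv.WeakIdomain.dvdpP[[b v] /= b0 bgE] : d %| g by rewrite dvdp_gcdr.
have [s [t [tT]]] := nonconstant_zero T d1 (mulf_neq0 a0 b0).
rewrite hornerM mulf_eq0 negb_or => /andP[at0 bt0] dst.
(* At a zero of [d] the product rule leaves only the derivative of [d], times the cofactor. *)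
have zeroP (c : {poly K}) q e : c.[t] != 0 -> c *: e = q * d ->
    [/\ e.[s, t] = 0, c.[t] * e^`().[s, t] = q.[s, t] * d^`().[s, t] &
     c.[t] * (derivY e).[s, t] = q.[s, t] * (derivY d).[s, t]].
  move=> ct ceE; have est : e.[s, t] = 0.
    by apply: (mulfI ct); rewrite mulr0 -horner2Z ceE !hornerM dst mulr0.
  split=> //; first by rewrite -horner2Z -derivZ ceE derivM !(hornerD, hornerM) dst; ring.
  have := congr1 (fun p => (derivY p).[s, t]) ceE.
  by rewrite derivYZ derivYM !(hornerD, hornerM, horner2Z) est dst !mulr0 !add0r.
have [fst fx fy] := zeroP _ _ _ at0 afE; have [gst gx gy] := zeroP _ _ _ bt0 bgE.
exists s, t; split=> //; apply: (mulfI at0); apply: (mulfI bt0).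
transitivity ((a.[t] * f^`().[s, t]) * (b.[t] * (derivY g).[s, t])); first by ring.
by rewrite fx gy -mulrA [RHS]mulrCA [b.[t] * _]mulrCA gx [RHS]mulrA fy; ring.
Qed.

(** A Bezout relation between [f] and its derivative survives at almost every [t], so the
    specialised [f] stays separable of the same degree and the univariate root count applies to
    [h]. *)
Lemma separable_vanish f h T :
    separable_poly f -> (size h < size f)%N ->
    (forall s t, t \notin T -> f.[s, t] = 0 -> h.[s, t] = 0) -> h = 0.
Proof.
move=> sepf hf hT; have f0 := separable_poly_neq0 sepf.
move: sepf; rewrite unlock => /Bezout_coprimepP[[u v] /= /eqpP[[c1 c2] /=]].
case/andP=> _ c20 Euv; apply/eqP/negPn/negP => h0.
have lfh : c2 * lead_coef f * lead_coef h != 0 by rewrite !mulf_neq0 ?lead_coef_eq0.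
have [t tT] := nonroot_notin T lfh.
rewrite !hornerM !mulf_eq0 !negb_or => /andP[/andP[c2t lft] lht].
pose ev := map_poly (horner_eval t).
have szf : size (ev f) = size f by rewrite size_map_poly_id0.
have szh : size (ev h) = size h by rewrite size_map_poly_id0.
have evf0 : ev f != 0 by rewrite -size_poly_eq0 szf size_poly_eq0.
have evh0 : ev h != 0 by rewrite -size_poly_eq0 szh size_poly_eq0.
have sept : separable_poly (ev f).
  rewrite unlock; apply/Bezout_coprimepP; exists (ev u, ev v) => /=.
  apply/eqpP; exists (c1.[t], c2.[t]) => /=; first rewrite c2t andbT; last first.
    have := congr1 ev Euv; rewrite /ev !linearZ /= !rmorphD !rmorphM !rmorph1 /=.
    by rewrite -deriv_map.
  apply: contraNneq c2t => c1t; have := congr1 ev Euv.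
  rewrite /ev -!mul_polyC !rmorphM /= !map_polyC /= /horner_eval c1t mul0r.
  by rewrite !hornerE => /esym/eqP; rewrite polyC_eq0.
move/eqP: evh0; apply; apply: (separable_roots_eq0 sept); first by rewrite szf szh.
by move=> s; rewrite !horner2_map_poly; apply: hT.
Qed.

(** Truncated subtraction makes the coefficients of index above [d] vanish. *)
Definition total_degree_le (d : nat) p := forall i, (size (p`_i)%R <= d.+1 - i)%N.

Lemma total_degree_leD d p g :
  total_degree_le d p -> total_degree_le d g -> total_degree_le d (p + g).
Proof.
move=> dp dg i; rewrite coefD (leq_trans (size_polyD _ _)) // geq_max.
by rewrite dp dg.
Qed.

Lemma total_degree_leM d e p g :
  total_degree_le d p -> total_degree_le e g -> total_degree_le (d + e) (p * g).
Proof.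
move=> dp dg i; rewrite coefM; apply: (leq_trans (size_sum _ _ _)).
apply/bigmax_leqP => j _.
have ji : (j <= i)%N by rewrite -ltnS.
have [-> | pj0] := eqVneq p`_j 0; first by rewrite mul0r size_poly0.
have [-> | gj0] := eqVneq g`_(i - j) 0; first by rewrite mulr0 size_poly0.
rewrite size_mul //; move: (dp j) (dg (i - j)%N); rewrite -!size_poly_gt0 in pj0 gj0.
move: (size _) (size _) pj0 gj0 => a b; move: ji; lia.
Qed.

Lemma total_degree_leW d e p : (d <= e)%N -> total_degree_le d p -> total_degree_le e p.
Proof. by move=> de dp i; apply: leq_trans (dp i) _; rewrite leq_sub2r. Qed.

Lemma total_degree_le_size d p : total_degree_le d p -> (size p <= d.+1)%N.
Proof.
move=> dp; apply/leq_sizeP => j dj; apply/eqP; rewrite -size_poly_leq0.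
by apply: leq_trans (dp j) _; rewrite leqn0 subn_eq0.
Qed.

(** [r] is the coefficient of the pure power of the outer variable in top degree. It may be zero;
    when it is not, [f] has degree exactly [n] in that variable. *)
Definition has_top n (r : K) (f : {poly {poly K}}) := total_degree_le n f /\ f`_n = r%:P.

Lemma has_topM m n r u (f g : {poly {poly K}}) :
  has_top m r f -> has_top n u g -> has_top (m + n) (r * u) (f * g).
Proof.
move=> [bf tf] [bg tg]; split; first exact: total_degree_leM.
rewrite coefM (bigD1 (Ordinal (ltn_addr n (ltnSn m)))) //= addKn tf tg polyCM.
rewrite big1 ?addr0 // => j; rewrite -val_eqE /= => jm.
have [jlm|jgm] := ltnP j m.
  rewrite [g`_ _]nth_default ?mulr0 // (leq_trans (total_degree_le_size bg)) //.
  by rewrite ltn_subRL ltn_add2r.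
rewrite [f`_ _]nth_default ?mul0r // (leq_trans (total_degree_le_size bf)) //.
by rewrite ltn_neqAle eq_sym jm.
Qed.

Lemma total_degree_leC (r : K) : total_degree_le 0 r%:P%:P.
Proof.
by move=> i; rewrite coefC; case: eqP => [->|_]; rewrite ?size_poly0 // size_polyC_leq1.
Qed.

Lemma has_topX n r (f : {poly {poly K}}) i :
  has_top n r f -> has_top (n * i) (r ^+ i) (f ^+ i).
Proof.
move=> fr_top; elim: i => [|i IHi].
  by rewrite muln0 !expr0; split; [exact: total_degree_leC | rewrite coefC].
by rewrite !exprS mulnS; apply: has_topM.
Qed.

End BivariatePolynomials.

(** * Multivariate polynomials *)

Section MPolyGeneral.

Lemma mpoly_ring_ind (n : nat) (R : comNzRingType) (P : {mpoly R[n]} -> Prop) :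
    (forall c, P c%:MP) -> (forall i, P 'X_i) ->
    (forall p q, P p -> P q -> P (p + q)) ->
    (forall p q, P p -> P q -> P (p * q)) ->
  forall p, P p.
Proof.
move=> PC PX PD PM p; rewrite [p]mpolyE.
apply: big_ind => [|p1 p2|m _]; [by rewrite -mpolyC0 | exact: PD |].
rewrite -mul_mpolyC; apply: (PM) => //; rewrite mpolyXE_id.
apply: big_ind => [|p1 p2|i _]; [by rewrite -mpolyC1 | exact: PM |].
by elim: (m i) => [|d IHd]; rewrite ?expr0 -?mpolyC1 // exprS; apply: (PM).
Qed.

(** It serves to evaluate forms along parametrised curves and surfaces: [f] embeds the constants and
    [g] specialises the parameters. *)
Lemma rmorph_mmap (n : nat) (R S : comNzRingType) (f : {rmorphism R -> S})
    (g : {rmorphism S -> R}) (h : 'I_n -> S) p :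
  cancel f g -> g (mmap f h p) = p.@[g \o h].
Proof.
move=> fK; elim/mpoly_ring_ind: p => [c|i|p q IHp IHq|p q IHp IHq].
- by rewrite mmapC mevalC fK.
- by rewrite mmapX mmap1U mevalXU.
- by rewrite mmapD mevalD rmorphD IHp IHq.
- by rewrite mevalM -IHp -IHq -rmorphM -[in RHS]rmorphM.
Qed.

(** In characteristic 0 the integers supply more distinct points than [p] can have roots. *)
Lemma poly_nonroot (K : numDomainType) (p : {poly K}) :
  p != 0 -> exists t, p.[t] != 0.
Proof.
move=> p0; apply: contrapT => no; move: p0; apply/negP; rewrite negbK.
apply/eqP/(@roots_geq_poly_eq0 _ _ [seq i%:R | i <- iota 0 (size p)]).
- by apply/allP => t _; apply/negPn/negP => te; apply: no; exists t.
- rewrite map_inj_uniq ?iota_uniq // => i j /eqP.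
  by rewrite eqr_nat => /eqP.
- by rewrite size_map size_iota.
Qed.

(** Induction on the number of variables: first a point where the leading coefficient in the last
    variable is nonzero, then a value of that variable. *)
Lemma mpoly_nonroot (K : numDomainType) n (p : {mpoly K[n]}) :
  p != 0 -> exists v : 'I_n -> K, p.@[v] != 0.
Proof.
elim: n p => [|n IHn] p p0.
  exists (fun=> 0); move: p0; rewrite {1 2}[p]nvar0_mpolyC mevalC.
  by apply: contraNneq => ->.
(* [back] undoes [muni], whence [muni p] is nonzero. *)
pose back (q : {poly {mpoly K[n]}}) : {mpoly K[n.+1]} := (map_poly (@mwiden n K) q).['X_ord_max].
have back_muni q : back (muni q) = q.
  rewrite /back; elim/mpoly_ring_ind: q => [c|i|q r IHq IHr|q r IHq IHr].
  - by rewrite muniC map_polyC hornerC /= mwidenC.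
  - rewrite /muni mmapX mmap1U; case: splitP => j /= ij.
      rewrite map_polyC hornerC /= mwidenX mnmwiden1; congr 'X_[U_(_)].
      exact/val_inj.
    rewrite map_polyX hornerX; congr 'X_[U_(_)]; apply/val_inj => /=.
    by rewrite ij ord1 addn0.
  - by rewrite muniD [map_poly _ _]raddfD hornerD; congr (_ + _).
  - by rewrite muniM [map_poly _ _]rmorphM hornerM; congr (_ * _).
have : muni p != 0 by apply: contraNneq p0 => p0; rewrite -(back_muni p) p0 /back rmorph0 horner0.
rewrite -lead_coef_eq0 => /IHn[v lv].
pose e := map_poly (meval v) (muni p).
have e0 : e != 0.
  apply: contraNneq lv => ev0; apply/eqP.
  rewrite -[LHS]/(meval v _) -[lead_coef _]/((muni p)`_(size (muni p)).-1).
  by rewrite -coef_map -[map_poly _ _]/e ev0 coef0.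
have [t et] := poly_nonroot e0.
exists (fun i => if split (cast_ord (esym (addn1 n)) i) is inl j then v j else t).
apply: contraNneq et; move=> pw; apply/eqP; rewrite -[RHS]pw /e.
elim/mpoly_ring_ind: (p) => [c|i|q r IHq IHr|q r IHq IHr].
- by rewrite muniC map_polyC hornerC /= !mevalC.
- rewrite /muni mmapX mmap1U mevalXU; case: splitP => j _.
    by rewrite map_polyC hornerC /= mevalXU.
  by rewrite map_polyX hornerX.
- by rewrite muniD [map_poly _ _]raddfD hornerD mevalD; congr (_ + _).
- by rewrite muniM [map_poly _ _]rmorphM hornerM mevalM; congr (_ * _).
Qed.

End MPolyGeneral.

Section Homogeneous.
Variables (n : nat) (K : numClosedFieldType).
Implicit Types (p q l g U : {mpoly K[n]}) (x y z v : 'rV[K]_n).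

(** Derivative of [p] at [x] along [y]; for a quadratic form it is the polar bilinear form. *)
Definition dp p x y := \sum_j (p^`M(j)).@[x 0] * y 0 j.

Lemma dp_linear p x a y z : dp p x (a *: y + z) = a * dp p x y + dp p x z.
Proof.
rewrite /dp mulr_sumr -big_split; apply: eq_bigr => j _ /=.
by rewrite !mxE; ring.
Qed.

Lemma dp0r p x : dp p x 0 = 0.
Proof. by rewrite /dp big1 // => j _; rewrite mxE mulr0. Qed.

Lemma dpDr p x y z : dp p x (y + z) = dp p x y + dp p x z.
Proof. by rewrite -{1}[y]scale1r dp_linear mul1r. Qed.

Lemma dpZr p x a y : dp p x (a *: y) = a * dp p x y.
Proof. by rewrite -[_ *: y]addr0 dp_linear dp0r addr0. Qed.

Lemma dpD p q x y : dp (p + q) x y = dp p x y + dp q x y.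
Proof.
by rewrite /dp -big_split; apply: eq_bigr => j _ /=; rewrite mderivD mevalD mulrDl.
Qed.

Lemma dpZ a p x y : dp (a *: p) x y = a * dp p x y.
Proof.
by rewrite /dp mulr_sumr; apply: eq_bigr => j _ /=; rewrite mderivZ mevalZ mulrA.
Qed.

Lemma dpM p q x y : dp (p * q) x y = dp p x y * q.@[x 0] + p.@[x 0] * dp q x y.
Proof.
rewrite /dp mulr_sumr mulr_suml -big_split; apply: eq_bigr => j _ /=.
by rewrite mderivM mevalD !mevalM; ring.
Qed.

Lemma dpX i x y : dp 'X_i x y = y 0 i.
Proof.
rewrite /dp (bigD1 i) //= big1 => [|j ji].
  have UU : (U_(i) - U_(i) = 0 :> 'X_{1..n})%MM.
    by apply/mnmP => k; rewrite mnmBE subnn mnm0E.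
  by rewrite mderivX mnm1E eqxx UU addr0 mpolyX0 scale1r meval1 mul1r.
by rewrite mderivX mnm1E eq_sym (negPf ji) scale0r meval0 mul0r.
Qed.

Lemma meval_homogZ d p a x : p \is d.-homog -> p.@[(a *: x) 0] = a ^+ d * p.@[x 0].
Proof.
move/dhomogP => hp; rewrite !mevalE mulr_sumr; apply: eq_big_seq => m /hp md.
have {md} <- : mdeg m = d by []; rewrite mulrCA; congr (_ * _); rewrite mdegE -prodrXr -big_split.
by apply: eq_bigr => j _; rewrite /= mxE exprMn.
Qed.

Lemma dhomog_ind d (P : {mpoly K[n]} -> Prop) :
    P 0 -> (forall a p q, P p -> P q -> P (a *: p + q)) ->
    (forall m, mdeg m = d -> P 'X_[m]) ->
  forall p, p \is d.-homog -> P p.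
Proof.
move=> P0 PD PX p /dhomogP hp; rewrite [p]mpolyE big_seq.
elim/big_rec: _ => // m q mp Pq; apply: PD => //; exact/PX/hp.
Qed.

(** Multiplication by [p] shifts degrees by [d], so a component of [q] of degree other than [e]
    would give the product a component of the wrong degree. *)
Lemma dhomog_mulr d e p q :
  p != 0 -> p \is d.-homog -> p * q \is (d + e).-homog -> q \is e.-homog.
Proof.
move=> p0 hp hpq; rewrite homog_piE; apply/eqP.
suff other i : i != e -> pihomog mdeg i q = 0.
  have [w] : {w | (msize q <= w)%N & (e < w)%N}.
    by exists (maxn (msize q) e.+1); rewrite leq_max ?leqnn ?orbT.
  move=> qw ew; rewrite [RHS](pihomog_partitionE qw) (bigD1 (Ordinal ew)) //=.
  by rewrite big1 ?addr0 // => j je; rewrite other // -val_eqE.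
move=> ie; apply: (mulfI p0); rewrite mulr0.
have [w qw iw] : {w | (msize q <= w)%N & (i < w)%N}.
  by exists (maxn (msize q) i.+1); rewrite leq_max ?leqnn ?orbT.
have := pihomog_ne0 (b := (d + i)%N) _ hpq; rewrite eqn_add2l eq_sym => /(_ ie).
rewrite {1}(pihomog_partitionE qw) mulr_sumr raddf_sum /= (bigD1 (Ordinal iw)) //=.
rewrite big1 ?addr0 => [|j ji]; last first.
  apply: (@pihomog_ne0 _ _ _ (d + j)); first by rewrite eqn_add2l.
  by rewrite dhomogM ?pihomogP.
by rewrite pihomog_dE // dhomogM ?pihomogP.
Qed.

Lemma dhomog_degree d p : p != 0 -> p \is d.-homog -> msize p = d.+1.
Proof.
move=> p0 hp; rewrite (dhomog_uniq p0 hp (dhomog_msize hp)) prednK //.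
by rewrite lt0n mmeasure_poly_eq0.
Qed.

Lemma dhomog_factor d e p q :
  p * q != 0 -> p * q \is d.-homog -> q \is e.-homog ->
  (e <= d)%N /\ p \is (d - e).-homog.
Proof.
rewrite mulf_eq0 negb_or => /andP[p0 q0] hpq hq.
have pq0 : p * q != 0 by rewrite mulf_neq0.
have ed : (e <= d)%N.
  have := dhomog_degree pq0 hpq; rewrite msizeM // (dhomog_degree q0 hq) addnS /=.
  have : (0 < msize p)%N by rewrite lt0n mmeasure_poly_eq0.
  by case: (msize p) => // sz _ [<-]; rewrite leq_addl.
by split=> //; apply: (dhomog_mulr q0 hq); rewrite subnKC // mulrC.
Qed.

Lemma linear_form l : l \is 1.-homog ->
  (forall a x y, l.@[(a *: x + y) 0] = a * l.@[x 0] + l.@[y 0]) /\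
  (forall x y, dp l x y = l.@[y 0]).
Proof.
elim/dhomog_ind: l / => [|b l q [l1 l2] [q1 q2]|m].
- split=> [a x y|x y]; first by rewrite !meval0 mulr0 addr0.
  by rewrite /dp big1 ?meval0 // => j _; rewrite mderiv0 meval0 mul0r.
- split=> [a x y|x y]; first by rewrite !mevalD !mevalZ l1 q1; ring.
  by rewrite dpD dpZ mevalD mevalZ l2 q2.
- move/eqP/mdeg1P => [i /eqP ->].
  by split=> [a x y|x y]; rewrite ?dpX !mevalXU ?mxE.
Qed.

(** The identities are linear in [q], so they need checking only on products of two variables. *)
Lemma quadratic_form q : q \is 2.-homog ->
  [/\ forall x y, q.@[(x + y) 0] = q.@[x 0] + dp q x y + q.@[y 0],
      forall x y, dp q x y = dp q y x,
      forall x, dp q x x = 2%:R * q.@[x 0] &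
      forall a x y z, dp q (a *: x + y) z = a * dp q x z + dp q y z].
Proof.
elim/dhomog_ind: q / => [|b p q [p1 p2 p3 p4] [q1 q2 q3 q4]|m m2].
- have dp0 x y : dp 0 x y = 0.
    by rewrite /dp big1 // => j _; rewrite mderiv0 meval0 mul0r.
  by split=> [x y|x y|x|a x y z]; rewrite !dp0 ?meval0; ring.
- split=> [x y|x y|x|a x y z]; rewrite !dpD !dpZ ?mevalD ?mevalZ.
  + by rewrite p1 q1; ring.
  + by rewrite p2 q2.
  + by rewrite p3 q3; ring.
  + by rewrite p4 q4; ring.
- have [i mi] : exists i, m i != 0%N.
    apply: contrapT => no; have m0 : m = 0%MM.
      apply/mnmP => i; rewrite mnm0E; apply/eqP/negPn/negP => mi; apply: no.
      by exists i.
    by rewrite m0 mdeg0 in m2.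
  have [j Em] : exists j, m = (U_(i) + U_(j))%MM.
    have im : (U_(i) <= m)%MM by rewrite lep1mP.
    have /mdeg1P[j /eqP mj] : mdeg (m - U_(i)) == 1%N.
      by move/eqP: m2; rewrite -[X in mdeg X](submK im) mdegD mdeg1 addn1 eqSS.
    by exists j; rewrite -mj addmC submK.
  rewrite Em mpolyXD; split=> [x y|x y|x|a x y z]; rewrite ?dpM ?mevalM ?dpX ?mevalXU ?mxE; ring.
Qed.

End Homogeneous.

(** Chain rule for any derivation killing the constants; it serves for both partial derivatives of a
    chart. *)
Lemma derivation_mmap (n : nat) (K A : comNzRingType) (f : {rmorphism K -> A})
    (h : 'I_n -> A) (D : A -> A) :
    (forall a b, D (a + b) = D a + D b) ->
    (forall a b, D (a * b) = D a * b + a * D b) ->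
    (forall c, D (f c) = 0) ->
  forall p : {mpoly K[n]},
    D (mmap f h p) = \sum_j mmap f h p^`M(j) * D (h j).
Proof.
move=> DD DM DC; elim/mpoly_ring_ind => [c|i|p q IHp IHq|p q IHp IHq].
- by rewrite mmapC DC big1 // => j _; rewrite mderivC mmap0 mul0r.
- rewrite mmapX mmap1U (bigD1 i) //= big1 => [|j ji].
    have UU : (U_(i) - U_(i) = 0 :> 'X_{1..n})%MM.
      by apply/mnmP => k; rewrite mnmBE subnn mnm0E.
    by rewrite mderivX mnm1E eqxx UU addr0 mpolyX0 scale1r mmap_is_multiplicative mul1r.
  by rewrite mderivX mnm1E eq_sym (negPf ji) scale0r mmap0 mul0r.
- rewrite mmapD DD IHp IHq -big_split; apply: eq_bigr => j _ /=.
  by rewrite mderivD mmapD mulrDl.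
- rewrite [mmap f h (p * q)]rmorphM DM IHp IHq mulr_suml mulr_sumr -big_split.
  apply: eq_bigr => j _ /=; rewrite mderivM mmapD [mmap f h (_ * q)]rmorphM.
  by rewrite [mmap f h (p * _)]rmorphM /=; ring.
Qed.

Lemma map_poly_quadratic (R S : nzRingType) (f : {rmorphism R -> S}) b c :
  map_poly f ('X^2 + (b *: 'X + c%:P)) = 'X^2 + (f b *: 'X + (f c)%:P).
Proof. by rewrite !rmorphD /= map_polyXn map_polyZ map_polyX map_polyC. Qed.

(** * Division by a linear or quadratic form along parallel lines *)

Section DivisionAlongLines.
Variables (n : nat) (K : numClosedFieldType).
Implicit Types (p q l g U D : {mpoly K[n]}) (x y z v : 'rV[K]_n).

(** The expansion of [p(X + T v)] in powers of [T], where [X] is the generic point. *)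
Definition line_poly v p : {poly {mpoly K[n]}} :=
  mmap (polyC \o @mpolyC n K) (fun j => ('X_j)%:P + ((v 0 j)%:MP)%:P * 'X) p.

Lemma line_polyE v p x s :
  (map_poly (meval (x 0)) (line_poly v p)).[s] = p.@[(x + s *: v) 0].
Proof.
elim/mpoly_ring_ind: p => [c|i|p q IHp IHq|p q IHp IHq].
- by rewrite /line_poly mmapC map_polyC hornerC /= !mevalC.
- rewrite /line_poly mmapX mmap1U mevalXU rmorphD rmorphM /= !map_polyC map_polyX.
  by rewrite !hornerE /= mevalXU mevalC !mxE mulrC.
- rewrite /line_poly mmapD mevalD -IHp -IHq.
  by rewrite [map_poly _ _]raddfD hornerD.
- rewrite /line_poly [mmap _ _ (p * q)]rmorphM mevalM -IHp -IHq.
  by rewrite [map_poly _ _]rmorphM hornerM.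
Qed.

Lemma line_poly0 v p : (line_poly v p).[0] = p.
Proof.
elim/mpoly_ring_ind: p => [c|i|p q IHp IHq|p q IHp IHq].
- by rewrite /line_poly mmapC hornerC.
- by rewrite /line_poly mmapX mmap1U !hornerE.
- by rewrite /line_poly mmapD hornerD; congr (_ + _).
- by rewrite /line_poly [mmap _ _ (p * q)]rmorphM hornerM; congr (_ * _).
Qed.

Lemma mpoly_poly_eq0 (e : {poly {mpoly K[n]}}) :
  (forall x s, (map_poly (meval (x 0)) e).[s] = 0) -> e = 0.
Proof.
move=> ev0; apply/eqP/negPn/negP; rewrite -lead_coef_eq0 => /mpoly_nonroot[w].
pose x : 'rV[K]_n := \row_j w j; have wx : w =1 x 0 by move=> j; rewrite mxE.
rewrite (meval_eq _ wx) => /eqP; apply.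
have -> : (lead_coef e).@[x 0] = (map_poly (meval (x 0)) e)`_(size e).-1.
  by rewrite coef_map.
suff -> : map_poly (meval (x 0)) e = 0 by rewrite coef0.
by apply/eqP/negPn/negP => /poly_nonroot[s]; rewrite ev0 eqxx.
Qed.

(* Divide the restrictions to the lines of direction v: the remainder vanishes as
   soon as it does on the generic line, which meets g = 0 in distinct points. *)
Lemma dvd_along_lines g U v D :
    line_poly v g \is monic -> D != 0 ->
    (forall x, D.@[x 0] != 0 -> separable_poly (map_poly (meval (x 0)) (line_poly v g))) ->
    (forall x s, D.@[x 0] != 0 -> g.@[(x + s *: v) 0] = 0 -> U.@[(x + s *: v) 0] = 0) ->
  exists U', U = U' * g.
Proof.
move=> gm D0 Dsep DU.
have E := Pdiv.RingMonic.rdivp_eq gm (line_poly v U).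
set Q := Pdiv.CommonRing.rdivp _ _ in E; set R := Pdiv.CommonRing.rmodp _ _ in E.
have sR : (size R < size (line_poly v g))%N by rewrite Pdiv.CommonRing.ltn_rmodpN0 // monic_neq0.
have R0 : R = 0.
  (* Multiplying by [D] covers the points about which the hypotheses say nothing. *)
  have : D *: R = 0.
    apply: mpoly_poly_eq0 => x s; rewrite -mul_polyC [map_poly _ _]rmorphM hornerM /=.
    rewrite map_polyC hornerC /=.
    have [->|Dx] := eqVneq D.@[x 0] 0; first by rewrite mul0r.
    suff -> : map_poly (meval (x 0)) R = 0 by rewrite horner0 mulr0.
    apply: (separable_roots_eq0 (Dsep x Dx)).
      apply: leq_ltn_trans (size_poly _ _) _.
      by rewrite size_map_poly_id0 // (monicP gm) /= meval1 oner_eq0.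
    move=> t; rewrite line_polyE => gt; have := DU x t Dx gt.
    rewrite -line_polyE E [map_poly _ _]raddfD [X in X + _]rmorphM hornerD hornerM /=.
    by rewrite line_polyE gt mulr0 add0r.
  by move/eqP; rewrite -mul_polyC mulf_eq0 polyC_eq0 (negPf D0) => /eqP.
(* The division identity at parameter 0 relates [U] and [g] themselves. *)
exists Q.[0]; rewrite -{1}(line_poly0 v U) E R0 addr0 hornerM.
by rewrite line_poly0.
Qed.

(** Along [v] the form [l] becomes the monic ['X + l%:P], whose derivative is 1. The polynomial [D]
    restricts the vanishing hypothesis to generic lines. *)
Lemma linear_dvd l U v D : l \is 1.-homog -> l.@[v 0] = 1 -> D != 0 ->
    (forall x s, D.@[x 0] != 0 -> l.@[(x + s *: v) 0] = 0 -> U.@[(x + s *: v) 0] = 0) ->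
  exists U', U = U' * l.
Proof.
move=> hl lv D0 lU; have [l1 _] := linear_form hl.
have El : line_poly v l = 'X + l%:P.
  apply/eqP; rewrite -subr_eq0; apply/eqP/mpoly_poly_eq0 => x s.
  rewrite [map_poly _ _]raddfB /= hornerD hornerN line_polyE.
  rewrite [map_poly _ (_ + _)]raddfD /= map_polyX map_polyC.
  by rewrite !hornerE [x + _]addrC l1 lv mulr1 subrr.
apply: (@dvd_along_lines l U v D) => //.
- by rewrite El -[l]opprK polyCN monicXsubC.
- move=> x _; rewrite El [map_poly _ _]raddfD /= map_polyX map_polyC unlock derivD derivX derivC.
  by rewrite addr0 coprimep1.
Qed.

(** Along [v] the form is a monic quadratic polynomial. Its discriminant is not identically zero,
    since at [x1] it is [-4 q(x1)], so generic lines meet the quadric in two distinct points. *)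
Lemma quadratic_dvd q U v x1 D : q \is 2.-homog -> q.@[v 0] = 1 ->
    dp q x1 v = 0 -> q.@[x1 0] != 0 -> D != 0 ->
    (forall x s, D.@[x 0] != 0 -> q.@[(x + s *: v) 0] = 0 -> U.@[(x + s *: v) 0] = 0) ->
  exists U', U = U' * q.
Proof.
move=> hq qv qx1v qx1 D0 qU; have [q1 q2 q3 q4] := quadratic_form hq.
pose B : {mpoly K[n]} := \sum_j v 0 j *: q^`M(j).
have BE x : B.@[x 0] = dp q x v.
  by rewrite /B raddf_sum; apply: eq_bigr => j _; rewrite /= mevalZ mulrC.
have El : line_poly v q = 'X^2 + (B *: 'X + q%:P).
  apply/eqP; rewrite -subr_eq0; apply/eqP/mpoly_poly_eq0 => x s.
  rewrite [map_poly _ _]raddfB /= hornerD hornerN line_polyE map_poly_quadratic /=.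
  rewrite !hornerD hornerXn hornerZ hornerX hornerC BE q1 (meval_homogZ _ _ hq) qv.
  by rewrite dpZr; ring.
have mon : line_poly v q \is monic.
  have sz : (size (B *: 'X + q%:P)%R < size ('X^2 : {poly {mpoly K[n]}})%R)%N.
    rewrite size_polyXn; apply: leq_ltn_trans (size_polyD _ _) _.
    rewrite gtn_max ltnS (leq_trans (size_scale_leq _ _)) ?size_polyX //=.
    by rewrite ltnS (leq_trans (size_polyC_leq1 _)).
  by rewrite El monicE lead_coefDl // lead_coefXn.
pose disc := B ^+ 2 - 4%:R *: q.
have discE x : disc.@[x 0] = dp q x v ^+ 2 - 4%:R * q.@[x 0].
  by rewrite mevalB mevalZ rmorphXn /= BE.
apply: (@dvd_along_lines q U v (D * disc)) => //.
- rewrite mulf_neq0 //; apply: contraNneq qx1 => disc0.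
  have := discE x1; rewrite disc0 meval0 qx1v expr0n sub0r => /esym/eqP.
  by rewrite oppr_eq0 mulf_eq0 pnatr_eq0.
- move=> x; rewrite mevalM mulf_eq0 negb_or discE => /andP[_ dx].
  rewrite El map_poly_quadratic /= BE.
  rewrite unlock; apply/Bezout_coprimepP.
  (* The square of the derivative minus four times the quadratic polynomial is its discriminant. *)
  exists (- 4%:R%:P, 2%:R *: 'X + (dp q x v)%:P) => /=.
  apply/eqpP; exists (1, dp q x v ^+ 2 - 4%:R * q.@[x 0]); first by rewrite oner_eq0.
  rewrite scale1r derivD derivXn derivD derivZ derivX derivC addr0.
  rewrite -!mul_polyC !(polyCB, polyCM, polyC_exp, polyC_natr) -mulr_natl.
  by rewrite /= expr1; ring.
- by move=> x s; rewrite mevalM mulf_eq0 negb_or => /andP[Dx _]; apply: qU.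
Qed.

End DivisionAlongLines.

(** * Points and conics of the projective space *)

Section Freeness.
Variables (K : fieldType) (d : nat).
Implicit Types (a b c e g x y : 'rV[K]_d).

Lemma free_row_free n (X : n.-tuple 'rV[K]_d) :
  free X = row_free (\matrix_(i < n) X`_i).
Proof.
have comb (u : 'rV[K]_n) : u *m (\matrix_(i < n) X`_i) = \sum_i u 0 i *: X`_i.
  by rewrite mulmx_sum_row; apply: eq_bigr => i _; rewrite rowK.
apply/freeP/idP => [fX|rX u u0 i].
  apply: inj_row_free => u; rewrite comb => u0; apply/rowP => i.
  by rewrite mxE (fX _ u0).
pose w := \row_j u j; have : w *m (\matrix_(i < n) X`_i) = 0 *m (\matrix_(i < n) X`_i).
  rewrite mul0mx comb -[RHS]u0; apply: eq_bigr => j _.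
  by rewrite mxE.
by move/(row_free_inj rX)/rowP/(_ i); rewrite !mxE.
Qed.

(** Orthogonal row spaces have ranks adding up to at most [d]. Contradictions with transversality
    and with ordinary triple points come from this count. *)
Lemma free_annihilated n m (X : n.-tuple 'rV[K]_d) (Y : m.-tuple 'rV[K]_d) :
    free X -> free Y -> (forall (i : 'I_n) (j : 'I_m), X`_i *m (Y`_j)^T = 0) -> (n + m <= d)%N.
Proof.
rewrite !free_row_free => /eqP rX /eqP rY XY.
set A := \matrix_i X`_i in rX; set B := \matrix_i Y`_i in rY.
have : A *m B^T = 0.
  apply/matrixP => i j; have /matrixP/(_ 0 0) := XY i j; rewrite !mxE => XYij.
  by rewrite -[RHS]XYij; apply: eq_bigr => k _; rewrite !mxE.
by move/mulmx0_rank_max; rewrite mxrank_tr rX rY.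
Qed.

Lemma free2P a b : reflect (forall s t, s *: a + t *: b = 0 -> s = 0 /\ t = 0)
  (free [:: a; b]).
Proof.
apply: (iffP (@freeP _ _ _ [tuple a; b])) => [H s t st|H k].
  pose k (i : 'I_2) := [:: s; t]`_i.
  have k0 : \sum_(i < 2) k i *: [:: a; b]`_i = 0.
    by rewrite !big_ord_recl big_ord0 /k /= addr0.
  by split; [apply: (H k k0 0) | apply: (H k k0 1)].
rewrite !big_ord_recl big_ord0 /= addr0 => /H[k0 k1] i.
by case: i => [[|[|//]] lt]; [rewrite -[RHS]k0 | rewrite -[RHS]k1];
  congr k; apply/val_inj.
Qed.

Lemma free3P a b c : reflect
  (forall s t u, s *: a + t *: b + u *: c = 0 -> [/\ s = 0, t = 0 & u = 0])
  (free [:: a; b; c]).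
Proof.
apply: (iffP (@freeP _ _ _ [tuple a; b; c])) => [H s t u st|H k].
  pose k (i : 'I_3) := [:: s; t; u]`_i.
  have k0 : \sum_(i < 3) k i *: [:: a; b; c]`_i = 0.
    by rewrite !big_ord_recl big_ord0 /k /= addr0 addrA.
  by split; [apply: (H k k0 0) | apply: (H k k0 1) | apply: (H k k0 (Ordinal (isT : 2 < 3)%N))].
rewrite !big_ord_recl big_ord0 /= addr0 addrA => /H[k0 k1 k2] i.
by case: i => [[|[|[|//]]] lt]; [rewrite -[RHS]k0 | rewrite -[RHS]k1 | rewrite -[RHS]k2];
  congr k; apply/val_inj.
Qed.

Lemma free4P a b c e : reflect
  (forall s t u v, s *: a + t *: b + u *: c + v *: e = 0 -> [/\ s = 0, t = 0, u = 0 & v = 0])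
  (free [:: a; b; c; e]).
Proof.
apply: (iffP (@freeP _ _ _ [tuple a; b; c; e])) => [H s t u v st|H k].
  pose k (i : 'I_4) := [:: s; t; u; v]`_i.
  have k0 : \sum_(i < 4) k i *: [:: a; b; c; e]`_i = 0.
    by rewrite !big_ord_recl big_ord0 /k /= addr0 !addrA.
  by split; [apply: (H k k0 0) | apply: (H k k0 1) | apply: (H k k0 (Ordinal (isT : 2 < 4)%N))
    | apply: (H k k0 (Ordinal (isT : 3 < 4)%N))].
rewrite !big_ord_recl big_ord0 /= addr0 !addrA => /H[k0 k1 k2 k3] i.
by case: i => [[|[|[|[|//]]]] lt];
  [rewrite -[RHS]k0 | rewrite -[RHS]k1 | rewrite -[RHS]k2 | rewrite -[RHS]k3];
  congr k; apply/val_inj.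
Qed.

Lemma free_extend (X : seq 'rV[K]_d) : free X -> (size X < d)%N ->
  exists b, free (rcons X b).
Proof.
move=> fX sX; have [b bX] : exists b, b \notin <<X>>%VS.
  apply: contrapT => no; have : (fullv <= <<X>>)%VS.
    by apply/subvP => b _; apply/negPn/negP => bX; apply: no; exists b.
  by move/dimvS; rewrite dimvf /dim /= mul1n (eqP fX) leqNgt sX.
exists b; have /perm_free -> : perm_eq (rcons X b) (b :: X) by rewrite perm_rcons.
by rewrite free_cons bX.
Qed.

End Freeness.

Lemma free4_span (K : fieldType) (a b c e x : 'rV[K]_4) : free [:: a; b; c; e] ->
  exists s t u v, x = s *: a + t *: b + u *: c + v *: e.
Proof.
move=> fX; have : x \in <<[tuple a; b; c; e]>>%VS.
  suff -> : <<[tuple a; b; c; e]>>%VS = fullv by rewrite memvf.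
  apply/eqP; rewrite eqEdim subvf dimvf /dim /= mul1n.
  by have /eqP -> := fX.
move/coord_span => ->.
rewrite !big_ord_recl big_ord0 /= addr0 !addrA.
by do 4!eexists.
Qed.

Section Points.
Variable K : numClosedFieldType.
Implicit Types (x : P3 K) (v w : 'rV[K]_4) (p l q : {mpoly K[4]}).

Definition hvec x : 'rV[K]_4 := vpick (val x).

Lemma hvec_neq0 x : hvec x != 0.
Proof. by rewrite vpick0 -dimv_eq0 (eqP (valP x)). Qed.

Lemma hvec_span x : val x = <[hvec x]>%VS.
Proof.
apply/esym/eqP; rewrite eqEdim (eqP (valP x)) dim_vline hvec_neq0 andbT.
by rewrite -memvE memv_pick.
Qed.

Lemma hvec_inj x y c : hvec x = c *: hvec y -> x = y.
Proof.
move=> xy; apply/val_inj; rewrite !hvec_span.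
have c0 : c != 0 by apply: contraNneq (hvec_neq0 x) => c0; rewrite xy c0 scale0r.
apply/vspaceP => v; apply/vlineP/vlineP => -[s ->].
  by exists (s * c); rewrite xy scalerA.
by exists (s / c); rewrite xy scalerA divfK.
Qed.

(** [vpick] may return any nonzero vector of the line, hence the factor [c]. *)
Lemma point_of v : v != 0 -> exists x : P3 K, exists2 c, c != 0 & hvec x = c *: v.
Proof.
move=> v0; have dv : \dim <[v]> == 1%N by rewrite dim_vline v0.
exists (exist _ <[v]>%VS dv); have /vlineP[c E] := memv_pick <[v]>%VS.
exists c => //; apply: contraTneq v0 => c0; move: E; rewrite c0 scale0r => /eqP.
by rewrite vpick0 -dimv_eq0 dim_vline; case: (v != 0).
Qed.

Lemma free_hvec x y : x <> y -> free [:: hvec x; hvec y].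
Proof.
move=> xy; apply/free2P => s t st.
have [s0|s0] := eqVneq s 0.
  split=> //; move/eqP: st; rewrite s0 scale0r add0r scaler_eq0.
  by rewrite (negPf (hvec_neq0 y)) orbF => /eqP.
case: xy; apply: (@hvec_inj _ _ (- t / s)); apply: (scalerI s0).
rewrite scalerA mulrC divfK // scaleNr; apply/eqP; rewrite -addr_eq0; exact/eqP.
Qed.

Lemma gradient_dp p x v : gradient p x *m v^T = (dp p (hvec x) v)%:M.
Proof.
apply/matrixP => i j; rewrite !ord1 !mxE eqxx mulr1n; apply: eq_bigr => k _.
by rewrite !mxE.
Qed.

(** A vector in the radical of the polar form lies on the quadric, because [dp q v v] is twice [q]
    at [v], and it would be a singular point. *)
Lemma quadric_nondegenerate q v : nonsingular_quadric q -> v != 0 ->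
  exists w, dp q v w != 0.
Proof.
move=> [[q0 hq] sq] v0; have [q1 q2 q3 q4] := quadratic_form hq.
apply: contrapT => no; have dv w : dp q v w = 0.
  by apply: contrapT => /eqP dw; apply: no; exists w.
have [x [c c0 xv]] := point_of v0.
have dx w : dp q (hvec x) w = 0.
  by rewrite xv q2 dpZr q2 dv mulr0.
have := sq x; rewrite /zeros /= => /(_ _)/eqP; apply.
  have := dx (hvec x); rewrite q3 => /eqP; rewrite mulf_eq0 pnatr_eq0 /= => /eqP; exact.
apply/rowP => j; have := gradient_dp q x (delta_mx 0 j).
rewrite dx => /matrixP/(_ 0 0); rewrite trmx_delta -colE !mxE => ->.
by rewrite mul0rn.
Qed.

End Points.

Section QuadraticForms.
Variables (n : nat) (K : numClosedFieldType) (q : {mpoly K[n]}).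
Hypothesis hq : q \is 2.-homog.
Implicit Types (a b c x y z : 'rV[K]_n) (s t u : K).

Lemma quadD x y : q.@[(x + y) 0] = q.@[x 0] + dp q x y + q.@[y 0].
Proof. by case: (quadratic_form hq). Qed.

Lemma dpC x y : dp q x y = dp q y x.
Proof. by case: (quadratic_form hq). Qed.

Lemma dp_diag x : dp q x x = 2%:R * q.@[x 0].
Proof. by case: (quadratic_form hq). Qed.

Lemma dpDl x y z : dp q (x + y) z = dp q x z + dp q y z.
Proof. by rewrite dpC dpDr !(dpC z). Qed.

Lemma dpZl s x z : dp q (s *: x) z = s * dp q x z.
Proof. by rewrite dpC dpZr dpC. Qed.

Lemma quadZ s x : q.@[(s *: x) 0] = s ^+ 2 * q.@[x 0].
Proof. exact: meval_homogZ. Qed.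

Lemma quad_comb2 s t a b : q.@[(s *: a + t *: b) 0] =
  s ^+ 2 * q.@[a 0] + t ^+ 2 * q.@[b 0] + s * t * dp q a b.
Proof. by rewrite quadD dpZl dpZr !quadZ; ring. Qed.

Lemma quad_comb3 s t u a b c : q.@[(s *: a + t *: b + u *: c) 0] =
  s ^+ 2 * q.@[a 0] + t ^+ 2 * q.@[b 0] + u ^+ 2 * q.@[c 0]
  + s * t * dp q a b + s * u * dp q a c + t * u * dp q b c.
Proof. by rewrite quadD quad_comb2 dpDl !dpZl !dpZr !quadZ; ring. Qed.

End QuadraticForms.

Section Conics.
Variable K : numClosedFieldType.
Implicit Types (x : P3 K) (v w : 'rV[K]_4) (p l q : {mpoly K[4]}).

Lemma linear_eval2 l s t v w : l \is 1.-homog ->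
  l.@[(s *: v + t *: w) 0] = s * l.@[v 0] + t * l.@[w 0].
Proof.
by move=> hl; have [l1 _] := linear_form hl; rewrite l1 (meval_homogZ _ _ hl) expr1.
Qed.

Lemma linear_eval3 l s t u v w e : l \is 1.-homog ->
  l.@[(s *: v + t *: w + u *: e) 0] = s * l.@[v 0] + t * l.@[w 0] + u * l.@[e 0].
Proof.
move=> hl; have [l1 _] := linear_form hl.
by rewrite addrC l1 linear_eval2 // addrC.
Qed.

Lemma mpoly_vector_nonroot p : p != 0 -> exists v, p.@[v 0] != 0.
Proof.
move=> /mpoly_nonroot[f pf]; exists (\row_j f j); apply: contraNneq pf => <-.
by apply/eqP/meval_eq => j; rewrite mxE.
Qed.

Lemma not_transverse_at l q x (a b c : 'rV[K]_4) : free [:: a; b; c] ->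
  (forall v, v \in [:: a; b; c] -> dp l (hvec x) v = 0) ->
  (forall v, v \in [:: a; b; c] -> dp q (hvec x) v = 0) -> ~~ transverse_at l q x.
Proof.
move=> fabc lv qv; apply/negP => tr.
suff : (2 + 3 <= 4)%N by [].
apply: (@free_annihilated _ 4 2 3 [tuple gradient l x; gradient q x] [tuple a; b; c] tr fabc).
have mem_j (j : 'I_3) : [:: a; b; c]`_j \in [:: a; b; c] by apply/mem_nth/ltn_ord.
by case=> -[|[|i]] // ilt j; rewrite gradient_dp ?lv ?qv ?raddf0 // mem_j.
Qed.

Lemma plane_basis l (a b : 'rV[K]_4) : l \is 1.-homog -> l != 0 -> free [:: a; b] ->
    l.@[a 0] = 0 -> l.@[b 0] = 0 ->
  exists e f, [/\ free [:: a; b; e; f], l.@[e 0] = 0 & l.@[f 0] != 0].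
Proof.
move=> hl l0 fab la lb.
have [b3 /= f3] := free_extend fab isT; have [b4 /= f4] := free_extend f3 isT.
have [f lf] := mpoly_vector_nonroot l0.
have [s [t [u [v fE]]]] := free4_span f f4.
(* The combination of [b3] and [b4] killed by [l]; its coefficients are not both zero, as otherwise
   [l] would vanish at [f] too. *)
pose e := l.@[b4 0] *: b3 - l.@[b3 0] *: b4.
have le : l.@[e 0] = 0 by rewrite /e -scaleNr linear_eval2 //; ring.
exists e, f; split=> //; apply/free4P => s' t' u' v' rel.
have v'0 : v' = 0.
  have := congr1 (fun x : 'rV__ => l.@[x 0]) rel.
  rewrite -[X in X + _]scale1r linear_eval2 // linear_eval3 // la lb le.
  have -> : l.@[(0 : 'rV[K]_4) 0] = 0 by rewrite -(scale0r 0) (meval_homogZ _ _ hl) expr1 mul0r.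
  rewrite !mulr0 !addr0 mul1r add0r => /eqP; rewrite mulf_eq0 (negPf lf) orbF => /eqP //.
have /free4P/(_ s' t' (u' * l.@[b4 0]) (- u' * l.@[b3 0])) := f4.
case=> [|-> -> u3 u4].
  rewrite -[RHS]rel v'0; apply/rowP => j; rewrite !mxE; ring.
split=> //; have [//|u'0] := eqVneq u' 0.
have lb3 : l.@[b3 0] = 0.
  by move/eqP: u4; rewrite mulf_eq0 oppr_eq0 (negPf u'0) => /eqP.
have lb4 : l.@[b4 0] = 0 by move/eqP: u3; rewrite mulf_eq0 (negPf u'0) => /eqP.
move: lf; rewrite fE -[X in X + _]scale1r linear_eval2 // linear_eval3 //.
by rewrite la lb lb3 lb4 !mulr0 !addr0 mulr0 eqxx.
Qed.
(** In the coordinates [s], [t], [u] of the plane [l = 0] the conic is [s * t = c * u ^+ 2]: it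
    passes through [a1] and [a2], and its tangents there meet at [e]. *)
Definition conic_frame (C : set (P3 K)) (a1 a2 : 'rV[K]_4) l (e : 'rV[K]_4) c :=
  [/\ surface 1 l,
      [/\ l.@[a1 0] = 0, l.@[a2 0] = 0, l.@[e 0] = 0 & c != 0],
      free [:: a1; a2; e],
      forall v, l.@[v 0] = 0 -> exists s t u, v = s *: a1 + t *: a2 + u *: e &
      forall x, C x <-> exists s t u,
        hvec x = s *: a1 + t *: a2 + u *: e /\ s * t = c * u ^+ 2].

Lemma conic_frame_exists (C : set (P3 K)) (v1 v2 : P3 K) :
  nonsingular_conic C -> v1 <> v2 -> C v1 -> C v2 ->
  exists l e c, conic_frame C (hvec v1) (hvec v2) l e c.
Proof.
move=> [l [q [[l0 hl] [q0 hq] CE tr]]] v12 Cv1 Cv2.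
set a1 := hvec v1; set a2 := hvec v2.
have Cx x : C x <-> l.@[hvec x 0] = 0 /\ q.@[hvec x 0] = 0 by rewrite CE.
have [la1 qa1] := (Cx v1).1 Cv1; have [la2 qa2] := (Cx v2).1 Cv2.
have f12 : free [:: a1; a2] by exact: free_hvec.
have [e0 [f [ff le0 lf]]] := plane_basis hl l0 f12 la1 la2.
have span v : l.@[v 0] = 0 -> exists s t u, v = s *: a1 + t *: a2 + u *: e0.
  have [s [t [u [k ->]]]] := free4_span v ff.
  rewrite -[X in X + _]scale1r linear_eval2 // linear_eval3 // la1 la2 le0.
  rewrite !mulr0 !addr0 mulr0 add0r => /eqP; rewrite mulf_eq0 (negPf lf) orbF => /eqP ->.
  by exists s, t, u; rewrite scale0r addr0 scale1r.
have f120 : free [:: a1; a2; e0].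
  apply/free3P => s t u stu; have /free4P/(_ s t u 0)[] // := ff.
  by rewrite scale0r addr0.
(* At such a point of the conic the gradients of [l] and [q] would both kill the whole plane. *)
have sing v : v != 0 -> l.@[v 0] = 0 -> q.@[v 0] = 0 -> dp q v a1 = 0 ->
    dp q v a2 = 0 -> dp q v e0 = 0 -> False.
  move=> vn0 lv qv d1 d2 d0; have [x [k k0 xE]] := point_of vn0.
  have Cxx : C x.
    by apply/Cx; rewrite xE (meval_homogZ _ _ hl) (quadZ hq) lv qv !mulr0.
  move: (tr x Cxx); apply/negP/(not_transverse_at f120) => w.
    have [_ ->] := linear_form hl; rewrite !inE.
    by case/or3P=> /eqP ->.
  rewrite xE (dpZl hq) !inE => /or3P[] /eqP ->; first by rewrite d1 mulr0.
    by rewrite d2 mulr0.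
  by rewrite d0 mulr0.
have dd v : q.@[v 0] = 0 -> dp q v v = 0 by rewrite (dp_diag hq) => ->; rewrite mulr0.
pose beta := dp q a1 a2.
(* Otherwise the line joining [a1] and [a2] lies on the conic, and its point orthogonal to [e0] is
   singular. *)
have beta0 : beta != 0.
  apply/eqP => b0.
  have [s [t [st0 st]]] : exists s t, (s != 0) || (t != 0) /\
      s * dp q a1 e0 + t * dp q a2 e0 = 0.
    have [z1|nz1] := eqVneq (dp q a1 e0) 0.
      by exists 1, 0; rewrite z1 oner_eq0 mulr0 mul0r addr0.
    by exists (dp q a2 e0), (- dp q a1 e0); rewrite oppr_eq0 nz1 orbT; split=> //; ring.
  apply: (sing (s *: a1 + t *: a2)).
  - apply/eqP => z; have /free2P/(_ s t z)[s0 t0] := f12.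
    by move: st0; rewrite s0 t0 eqxx.
  - by rewrite linear_eval2 // la1 la2 !mulr0 addr0.
  - by rewrite (quad_comb2 hq) qa1 qa2 -/beta b0 !mulr0 !addr0.
  - by rewrite (dpDl hq) !(dpZl hq) (dd _ qa1) (dpC hq a2) -/beta b0 !mulr0 addr0.
  - by rewrite (dpDl hq) !(dpZl hq) (dd _ qa2) -/beta b0 !mulr0 addr0.
  - by rewrite (dpDl hq) !(dpZl hq).
(* This correction of [e0] is orthogonal to both [a1] and [a2]. *)
pose e := e0 - (dp q e0 a2 / beta) *: a1 - (dp q e0 a1 / beta) *: a2.
have eE s t u : s *: a1 + t *: a2 + u *: e =
   (s - u * (dp q e0 a2 / beta)) *: a1 + (t - u * (dp q e0 a1 / beta)) *: a2 + u *: e0.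
  by apply/rowP => j; rewrite !mxE; ring.
have e0E s t u : s *: a1 + t *: a2 + u *: e0 =
   (s + u * (dp q e0 a2 / beta)) *: a1 + (t + u * (dp q e0 a1 / beta)) *: a2 + u *: e.
  by apply/rowP => j; rewrite !mxE; ring.
have ee : e = 0 *: a1 + 0 *: a2 + 1 *: e by rewrite !scale0r !add0r scale1r.
have le : l.@[e 0] = 0 by rewrite ee eE linear_eval3 // la1 la2 le0; ring.
have de1 : dp q e a1 = 0.
  rewrite /e -!scaleNr !(dpDl hq) !(dpZl hq) (dd _ qa1) (dpC hq a2) -/beta.
  by rewrite mulr0 addr0 mulNr divfK // subrr.
have de2 : dp q e a2 = 0.
  rewrite /e -!scaleNr !(dpDl hq) !(dpZl hq) (dd _ qa2) -/beta.
  by rewrite mulr0 addr0 mulNr divfK // subrr.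
have fe : free [:: a1; a2; e].
  apply/free3P => s t u; rewrite eE => /(free3P _ _ _ f120)[s0 t0 u0].
  by move: s0 t0; rewrite u0 !mul0r !subr0 => -> ->.
have qe : q.@[e 0] != 0.
  apply/eqP => qe; apply: (sing e) => //.
    apply/eqP => e0'; have /free3P/(_ 0 0 1)[] := fe.
      by rewrite e0' scaler0 !scale0r !addr0.
    by move=> _ _ /eqP; rewrite oner_eq0.
  have -> : e0 = (dp q e0 a2 / beta) *: a1 + (dp q e0 a1 / beta) *: a2 + 1 *: e.
    by apply/rowP => j; rewrite !mxE; ring.
  by rewrite !dpDr !dpZr de1 de2 (dd _ qe) !mulr0 !addr0.
exists l, e, (- (q.@[e 0] / beta)); split=> //.
- by split=> //; rewrite oppr_eq0 mulf_neq0 ?invr_eq0.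
- move=> v /span[s [t [u ->]]]; rewrite e0E.
  by exists (s + u * (dp q e0 a2 / beta)), (t + u * (dp q e0 a1 / beta)), u.
have qE s t u : q.@[(s *: a1 + t *: a2 + u *: e) 0] = beta * (s * t + q.@[e 0] / beta * u ^+ 2).
  rewrite (quad_comb3 hq) qa1 qa2 (dpC hq _ e) (dpC hq _ e) de1 de2 -/beta.
  rewrite mulrDr !mulrA [beta * q.@[_]]mulrC mulfK //; ring.
move=> x; rewrite Cx; split=> [[lx qx]|[s [t [u [-> stu]]]]].
  have [s [t [u xE]]] := span _ lx; move: qx; rewrite xE e0E qE => /eqP.
  rewrite mulf_eq0 (negPf beta0) addr_eq0 => /eqP st.
  by do 3!eexists; split; first reflexivity; rewrite st mulNr.
split; first by rewrite linear_eval3 // la1 la2 le !mulr0 !addr0.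
by rewrite qE stu mulNr addNr mulr0.
Qed.

(** Along the parametrisation [(s ^+ 2, c, s)] of the conic, [q] is a polynomial in [s] that
    vanishes identically; its coefficients leave only a multiple of the equation of the conic. *)
Lemma quadric_on_conic C a1 a2 l e c q :
    conic_frame C a1 a2 l e c -> q \is 2.-homog -> (C `<=` zeros q)%classic ->
  forall s t u, q.@[(s *: a1 + t *: a2 + u *: e) 0] = dp q a1 a2 * (s * t - c * u ^+ 2).
Proof.
move=> [_ [_ _ _ c0] fe _ CE] hq Cq.
have qP s t u : s * t = c * u ^+ 2 -> q.@[(s *: a1 + t *: a2 + u *: e) 0] = 0.
  move=> stu; set v := (_ + _); have [->|v0] := eqVneq v 0.
    by rewrite -(scale0r 0) (quadZ hq) expr0n mul0r.
  have [x [k k0 xE]] := point_of v0.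
  have : C x.
    apply/CE; exists (k * s), (k * t), (k * u); rewrite xE !scalerDr !scalerA; split=> //.
    by rewrite mulrACA stu; ring.
  move/Cq; rewrite /zeros /= -[hcoord x]/(hvec x 0) xE (quadZ hq) => /eqP.
  by rewrite mulf_eq0 expf_eq0 (negPf k0) => /eqP.
have qa1 : q.@[a1 0] = 0.
  by have := qP 1 0 0; rewrite !scale0r !addr0 scale1r; apply; ring.
have qa2 : q.@[a2 0] = 0.
  by have := qP 0 1 0; rewrite !scale0r !addr0 add0r scale1r; apply; ring.
(* The value of [q] at [(s ^+ 2, c, s)]; the values at 1, -1 and 2 isolate its coefficients. *)
pose F s := s ^+ 3 * dp q a1 e + s ^+ 2 * (q.@[e 0] + c * dp q a1 a2) + s * (c * dp q a2 e).
have F0 s : F s = 0.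
  by have := qP (s ^+ 2) c s; rewrite (quad_comb3 hq) qa1 qa2 => <-; rewrite /F; ring.
have B0 : q.@[e 0] + c * dp q a1 a2 = 0.
  have -> : q.@[e 0] + c * dp q a1 a2 = (F 1 + F (-1)) / 2%:R by rewrite /F; field.
  by rewrite !F0 addr0 mul0r.
have d1 : dp q a1 e = 0.
  have -> : dp q a1 e = (F 2%:R - 2%:R * F 1 - 2%:R * (q.@[e 0] + c * dp q a1 a2)) / 6%:R.
    by rewrite /F; field.
  by rewrite !F0 B0 !mulr0 !subr0 mul0r.
have d2 : dp q a2 e = 0.
  apply: (mulfI c0); rewrite mulr0 -(F0 1) /F B0 d1; ring.
move=> s t u; rewrite (quad_comb3 hq) qa1 qa2 d1 d2.
have -> : q.@[e 0] = - (c * dp q a1 a2) by apply/eqP; rewrite -addr_eq0 B0.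
ring.
Qed.

(** Otherwise [q] vanishes on the whole plane, and a combination of [a1] and [a2] orthogonal to one
    vector outside the plane lies in the radical. *)
Lemma quadric_on_conic_neq0 C a1 a2 l e c q :
    conic_frame C a1 a2 l e c -> nonsingular_quadric q -> (C `<=` zeros q)%classic ->
  dp q a1 a2 != 0.
Proof.
move=> Cf nq Cq; have hq : q \is 2.-homog by case: nq => [[]].
have qE := quadric_on_conic Cf hq Cq; have [_ _ fe _ _] := Cf.
apply/eqP => B0; have q0 s t u : q.@[(s *: a1 + t *: a2 + u *: e) 0] = 0.
  by rewrite qE B0 mul0r.
have coef s t u : s ^+ 2 * q.@[a1 0] + t ^+ 2 * q.@[a2 0] + u ^+ 2 * q.@[e 0]
    + s * t * dp q a1 a2 + s * u * dp q a1 e + t * u * dp q a2 e = 0.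
  by rewrite -(quad_comb3 hq) q0.
have qa1 : q.@[a1 0] = 0 by rewrite -(coef 1 0 0); ring.
have qa2 : q.@[a2 0] = 0 by rewrite -(coef 0 1 0); ring.
have qe : q.@[e 0] = 0 by rewrite -(coef 0 0 1); ring.
have d1 : dp q a1 e = 0 by rewrite -(coef 1 0 1) qa1 qe; ring.
have d2 : dp q a2 e = 0 by rewrite -(coef 0 1 1) qa2 qe; ring.
have [f ff] := free_extend fe isT; rewrite /= in ff.
have [s [t [st0 st]]] : exists s t, (s != 0) || (t != 0) /\
    s * dp q a1 f + t * dp q a2 f = 0.
  have [z1|nz1] := eqVneq (dp q a1 f) 0.
    by exists 1, 0; rewrite z1 oner_eq0 mulr0 mul0r addr0.
  by exists (dp q a2 f), (- dp q a1 f); rewrite oppr_eq0 nz1 orbT; split=> //; ring.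
have n0 : s *: a1 + t *: a2 != 0.
  apply/eqP => z; have /free3P/(_ s t 0)[] := fe; first by rewrite z scale0r addr0.
  by move=> s0 t0 _; move: st0; rewrite s0 t0 eqxx.
have [w] := quadric_nondegenerate nq n0.
have [s' [t' [u' [v' ->]]]] := free4_span w ff.
set w' := (X in dp q _ X); suff -> : dp q (s *: a1 + t *: a2) w' =
    v' * (s * dp q a1 f + t * dp q a2 f) by rewrite st mulr0 eqxx.
rewrite /w' !(dpDl hq) !dpDr !dpZr !(dpZl hq) !(dp_diag hq) (dpC hq a2 a1) B0 d1 d2 qa1 qa2.
ring.
Qed.
End Conics.

Lemma separable_prod (R : idomainType) (I : eqType) (r : seq I) (P : pred I)
    (f : I -> {poly R}) :
    uniq r -> (forall i, P i -> separable_poly (f i)) ->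
    (forall i j, P i -> P j -> i != j -> coprimep (f i) (f j)) ->
  separable_poly (\prod_(i <- r | P i) f i).
Proof.
move=> ur sep cop; elim: r ur => [_|i r IHr /= /andP[ir ur]].
  by rewrite big_nil unlock coprime1p.
rewrite big_cons; case: ifP => Pi; last exact: IHr.
rewrite separable_mul sep // IHr //= big_seq_cond.
apply: (big_ind (fun g => coprimep (f i) g)) => [|g h cg ch|j /andP[jr Pj]].
- exact: coprimep1.
- by rewrite coprimepMr cg.
- by apply: cop => //; apply: contraNneq ir => ->.
Qed.

(** * Affine charts of a quadric *)

Section Chart.
Variable K : numClosedFieldType.
Implicit Types (v w b : 'rV[K]_4) (p g : {mpoly K[4]}).

(** A hyperbolic pair [x0], [y0] with a basis of its orthogonal complement; [q.@[a 0] = 1] makes [a]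
    a direction for division by [q]. *)
Definition quadric_frame (q : {mpoly K[4]}) (x0 y0 a c : 'rV[K]_4) :=
  [/\ free [:: x0; y0; a; c], q.@[x0 0] = 0, q.@[y0 0] = 0,
      dp q x0 y0 = 1 /\ q.@[a 0] = 1 &
      [/\ dp q x0 a = 0, dp q x0 c = 0, dp q y0 a = 0 & dp q y0 c = 0]].

Lemma quadric_frame_exists q (x0 : 'rV[K]_4) : nonsingular_quadric q -> x0 != 0 -> q.@[x0 0] = 0 ->
  exists y0 a c, quadric_frame q x0 y0 a c.
Proof.
move=> nq x00 qx0; have hq : q \is 2.-homog by case: nq => [[]].
have dd v : q.@[v 0] = 0 -> dp q v v = 0 by rewrite (dp_diag hq) => ->; rewrite mulr0.
have [y dy] : exists y, dp q x0 y = 1.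
  have [y1 d1] := quadric_nondegenerate nq x00.
  by exists ((dp q x0 y1)^-1 *: y1); rewrite dpZr mulVf.
have [y0 dy0 qy0] : exists2 y0, dp q x0 y0 = 1 & q.@[y0 0] = 0.
  exists (y - q.@[y 0] *: x0); first by rewrite -scaleNr dpDr dpZr (dd _ qx0) mulr0 addr0.
  by rewrite -scaleNr -[y]scale1r (quad_comb2 hq) scale1r qx0 (dpC hq y) dy; ring.
have f2 : free [:: x0; y0].
  apply/free2P => s t st; have t0 : t = 0.
    have := congr1 (dp q x0) st; rewrite dpDr !dpZr (dd _ qx0) dy0 dp0r.
    by rewrite mulr0 add0r mulr1.
  split=> //; move: st; rewrite t0 scale0r addr0 => /eqP.
  by rewrite scaler_eq0 (negPf x00) orbF => /eqP.
have [b3 /= f3] := free_extend f2 isT; have [b4 /= f4] := free_extend f3 isT.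
(* The projection onto the orthogonal complement of the hyperbolic plane. *)
pose pr v := v - dp q v y0 *: x0 - dp q v x0 *: y0.
have pr1 v : dp q x0 (pr v) = 0.
  by rewrite /pr -!scaleNr !dpDr !dpZr (dd _ qx0) dy0 (dpC hq v x0); ring.
have pr2 v : dp q y0 (pr v) = 0.
  by rewrite /pr -!scaleNr !dpDr !dpZr (dd _ qy0) (dpC hq y0 x0) dy0 (dpC hq v y0); ring.
have [e3 [e4 [fe [x3 x4] [y3 y4]]]] : exists e3 e4, [/\ free [:: x0; y0; e3; e4],
    dp q x0 e3 = 0 /\ dp q x0 e4 = 0 & dp q y0 e3 = 0 /\ dp q y0 e4 = 0].
  exists (pr b3), (pr b4); split=> //; apply/free4P => s t u v rel.
  have /free4P/(_ (s - u * dp q b3 y0 - v * dp q b4 y0)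
    (t - u * dp q b3 x0 - v * dp q b4 x0) u v) := f4.
  case=> [|s0 t0 u0 v0].
    by rewrite -[RHS]rel; apply/rowP => j; rewrite !mxE; ring.
  by move: s0 t0; rewrite u0 v0 !mul0r !subr0.
suff [a [c [fac qa [da dc] [da' dc']]]] : exists a c, [/\ free [:: x0; y0; a; c],
    q.@[a 0] != 0, dp q x0 a = 0 /\ dp q x0 c = 0 & dp q y0 a = 0 /\ dp q y0 c = 0].
  pose r := sqrtC q.@[a 0]; have r0 : r != 0 by rewrite sqrtC_eq0.
  exists y0, (r^-1 *: a), c; split=> //.
  - apply/free4P => s t u v; rewrite scalerA => /(free4P _ _ _ _ fac)[-> -> /eqP u0 ->].
    by move: u0; rewrite mulf_eq0 invr_eq0 (negPf r0) orbF => /eqP.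
  - by split=> //; rewrite (quadZ hq) -[q.@[_]]sqrtCK -/r exprVn mulVf // expf_neq0.
  - by rewrite !dpZr da da' mulr0.
have [q3|q3] := eqVneq q.@[e3 0] 0; last first.
  by exists e3, e4.
have [q4|q4] := eqVneq q.@[e4 0] 0; last first.
  exists e4, e3; split=> //.
  apply/free4P => s t u v st; have /free4P/(_ s t v u)[] // := fe.
  by rewrite -[RHS]st addrAC.
exists (e3 + e4), e3; rewrite !dpDr x3 x4 y3 y4 addr0; split=> //.
  apply/free4P => s t u v st; have /free4P/(_ s t (u + v) u)[] // := fe.
    by rewrite -[RHS]st; apply/rowP => j; rewrite !mxE; ring.
  by move=> s0 t0 uv u0; move: uv; rewrite u0 add0r => ->.
(* If [q] vanishes at [e3], [e4] and [e3 + e4], then [e3] is orthogonal to the whole basis. *)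
rewrite (quadD hq) q3 q4 add0r addr0; apply/eqP => d34.
have e30 : e3 != 0.
  apply/eqP => e30; have /free4P/(_ 0 0 1 0)[] := fe.
    by rewrite e30 !scale0r scaler0 !addr0.
  by move=> _ _ /eqP; rewrite oner_eq0.
have [w] := quadric_nondegenerate nq e30.
have [s [t [u [v ->]]]] := free4_span w fe.
rewrite !dpDr !dpZr (dpC hq _ x0) (dpC hq _ y0) x3 y3 (dd _ q3) d34.
by rewrite !mulr0 !addr0 eqxx.
Qed.

Variables (q : {mpoly K[4]}) (x0 y0 a c : 'rV[K]_4).
Hypotheses (hq : q \is 2.-homog) (fr : quadric_frame q x0 y0 a c).

(* The affine chart dp q v x0 = 1 of the cone q = 0, when q.@[a 0] = 1. *)
Definition chart s t : 'rV[K]_4 :=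
  y0 + s *: a + t *: c - (s ^+ 2 + s * t * dp q a c + t ^+ 2 * q.@[c 0]) *: x0.

Definition chart_poly p : {poly {poly K}} :=
  mmap (polyC \o @polyC K) (fun j => (y0 0 j)%:P%:P + (a 0 j)%:P *: 'X + ((c 0 j) *: 'X)%:P
    - (x0 0 j)%:P *: ('X^2 + (dp q a c *: 'X) *: 'X + (q.@[c 0] *: 'X^2)%:P)) p.

Lemma chart_polyE p s t : (chart_poly p).[s, t] = p.@[chart s t 0].
Proof.
rewrite -[LHS]/((horner_eval t \o horner_eval s%:P) (chart_poly p)) rmorph_mmap.
  apply: meval_eq => j; rewrite /= /horner_eval !mxE.
  by rewrite !(hornerD, hornerN, hornerZ, hornerX, hornerXn, hornerC, hornerM, horner_exp); ring.
by move=> r /=; rewrite /horner_eval !hornerC.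
Qed.

Lemma chart_quadric s t : q.@[chart s t 0] = 0.
Proof.
have [_ qx qy [xy qa] [xa xc ya yc]] := fr.
rewrite /chart -scaleNr -[y0]scale1r [q.@[_]](quadD hq) (quad_comb3 hq) !(dpDl hq) !(dpZl hq).
rewrite !dpZr !(quadZ hq) qx qy qa ya yc (dpC hq y0 x0) (dpC hq a x0) (dpC hq c x0) xy xa xc.
ring.
Qed.

Definition chart_dx s t := a - (2%:R * s + t * dp q a c) *: x0.
Definition chart_dy s t := c - (s * dp q a c + 2%:R * t * q.@[c 0]) *: x0.

Lemma chart_poly_deriv p s t :
  (chart_poly p)^`().[s, t] = dp p (chart s t) (chart_dx s t).
Proof.
rewrite /chart_poly derivation_mmap.
- rewrite !horner_sum; apply: eq_bigr => j _.
  rewrite !hornerM chart_polyE; congr (_ * _).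
  rewrite !mxE !derivE /=.
  by rewrite !(hornerD, hornerN, hornerZ, hornerX, hornerXn, hornerC, hornerM, horner_exp); ring.
- exact: derivD.
- exact: derivM.
- by move=> r /=; rewrite derivC.
Qed.

Lemma chart_poly_derivY p s t :
  (derivY (chart_poly p)).[s, t] = dp p (chart s t) (chart_dy s t).
Proof.
rewrite /chart_poly derivation_mmap.
- rewrite !horner_sum; apply: eq_bigr => j _.
  rewrite !hornerM chart_polyE; congr (_ * _).
  rewrite !mxE expr2 !(derivYD, derivYN, derivYZ, derivYM, derivYC, derivYX) !derivE /=.
  by rewrite !(hornerD, hornerN, hornerZ, hornerX, hornerXn, hornerC, hornerM, horner_exp); ring.
- exact: derivYD.
- exact: derivYM.
- by move=> r /=; rewrite derivYC derivC.
Qed.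

Lemma chart_free s t : free [:: chart s t; chart_dx s t; chart_dy s t].
Proof.
have [/free4P ff _ _ _ _] := fr; apply/free3P => u v w rel.
have [|_ u0 v0 w0] := ff (- (u * (s ^+ 2 + s * t * dp q a c + t ^+ 2 * q.@[c 0])) -
  v * (2%:R * s + t * dp q a c) - w * (s * dp q a c + 2%:R * t * q.@[c 0])) u
  (u * s + v) (u * t + w).
  by rewrite -[RHS]rel; apply/rowP => j; rewrite !mxE; ring.
by move: v0 w0; rewrite u0 !mul0r !add0r.
Qed.

(** With [chart_free], the chart point and the two partial derivatives span the tangent hyperplane
    of the cone. *)
Lemma chart_tangent s t :
  dp q (chart s t) (chart_dx s t) = 0 /\ dp q (chart s t) (chart_dy s t) = 0.
Proof.
have [_ qx qy [xy qa] [xa xc ya yc]] := fr.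
have [xx aa cc] : [/\ dp q x0 x0 = 0, dp q a a = 2%:R & dp q c c = 2%:R * q.@[c 0]].
  by rewrite !(dp_diag hq) qx qa mulr0 mulr1.
rewrite /chart /chart_dx /chart_dy -!scaleNr !(dpDl hq) !(dpZl hq) !dpDr !dpZr.
rewrite xx aa cc ya yc (dpC hq y0 x0) (dpC hq a x0) (dpC hq c x0) (dpC hq c a) xy xa xc.
by split; ring.
Qed.

(** The chart is quadratic in [s], [t] and its [s ^+ 2] term is [- x0]. Hence a form that is nonzero
    at [x0] attains the full degree in [s]. *)
Lemma chart_poly_top d p : p \is d.-homog ->
  has_top (2 * d) p.@[(- x0) 0] (chart_poly p).
Proof.
have bC := @total_degree_leC K.
have bCX (r : {poly K}) m : (size r <= m.+1)%N -> total_degree_le m r%:P.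
  by move=> rm i; rewrite coefC; case: eqP => [->|_]; rewrite ?size_poly0 ?subn0.
have bX : total_degree_le 1 ('X : {poly {poly K}}).
  by move=> [|[|i]]; rewrite coefX /= ?size_poly0 ?size_poly1.
have bY (r : K) m : total_degree_le m ((r *: 'X^m)%:P : {poly {poly K}}).
  by apply: bCX; rewrite (leq_trans (size_scale_leq _ _)) // size_polyXn.
have bN m f : total_degree_le m f -> total_degree_le m (- f : {poly {poly K}}).
  by move=> bf i; rewrite coefN size_polyN.
have b0 m : total_degree_le m (0 : {poly {poly K}}) by move=> i; rewrite coef0 size_poly0.
have bh j : has_top 2 (- x0 0 j) ((y0 0 j)%:P%:P + (a 0 j)%:P *: 'X + ((c 0 j) *: 'X)%:P
    - (x0 0 j)%:P *: ('X^2 + (dp q a c *: 'X) *: 'X + (q.@[c 0] *: 'X^2)%:P)).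
  split; last first.
    by rewrite !(coefD, coefN, coefC, coefZ, coefX, coefXn) /= !(mulr0, add0r, addr0) mulr1 polyCN.
  apply: total_degree_leD; last first.
    apply: bN; rewrite -mul_polyC; apply: (@total_degree_leM _ 0 2) => //.
    apply: total_degree_leD => //; apply: total_degree_leD.
      by rewrite expr2; apply: (@total_degree_leM _ 1 1).
    by rewrite -mul_polyC; apply: (@total_degree_leM _ 1 1) => //; exact: (bY _ 1).
  apply: (@total_degree_leW _ 1) => //; apply: total_degree_leD; last exact: (bY _ 1).
  apply: total_degree_leD; first exact: total_degree_leW (bC _).
  by rewrite -mul_polyC; apply: (@total_degree_leM _ 0 1).
elim/dhomog_ind: p / => [|r p g [bp tp] [bg tg]|m md].
- by rewrite /chart_poly mmap0 meval0; split; rewrite ?coef0.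
- rewrite /chart_poly mmapD mmapZ mevalD mevalZ; split.
    apply: total_degree_leD => //; rewrite -[(2 * d)%N]add0n.
    by apply: total_degree_leM => //; exact: bC.
  by rewrite /= coefD coefCM tp tg polyCD polyCM.
- rewrite /chart_poly mmapX mevalX /mmap1 -md mdegE big_distrr /=.
  apply: (big_rec3 (fun n f r => has_top n r f)).
    by split; [exact: bC | rewrite coefC].
  move=> j n f r _ bf; apply: has_topM => //.
  by rewrite mxE; apply: has_topX.
Qed.

Lemma chart_coord (s t u v : K) : dp q (s *: x0 + t *: y0 + u *: a + v *: c) x0 = t.
Proof.
have [_ qx qy [xy qa] [xa xc ya yc]] := fr.
rewrite !(dpDl hq) !(dpZl hq) (dpC hq y0) (dpC hq a) (dpC hq c) xy xa xc (dp_diag hq) qx; ring.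
Qed.

Lemma chart_onto w : q.@[w 0] = 0 -> dp q w x0 != 0 ->
  exists s t, w = dp q w x0 *: chart s t.
Proof.
have [ff qx qy [xy qa] [xa xc ya yc]] := fr.
have [s [t [u [v ->]]]] := free4_span w ff; rewrite chart_coord => qw t0.
exists (u / t), (v / t); have : s * t + (u ^+ 2 + u * v * dp q a c + v ^+ 2 * q.@[c 0]) = 0.
  rewrite -{}[RHS]qw (quadD hq) (quad_comb3 hq) !(dpDl hq) !(dpZl hq) !dpZr (quadZ hq).
  by rewrite qx qy qa ya yc xy xa xc; ring.
move/eqP; rewrite addr_eq0 => /eqP stE.
have -> : s = - (u ^+ 2 + u * v * dp q a c + v ^+ 2 * q.@[c 0]) / t by rewrite -stE mulfK.
by apply/rowP => j; rewrite !mxE; field.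
Qed.

(** The chart covers the quadric outside its tangent plane at [x0], and that plane is the
    exceptional [D] of [quadratic_dvd]. *)
Lemma chart_dvd d U : U \is d.-homog -> chart_poly U = 0 -> exists U', U = U' * q.
Proof.
move=> hU U0; have [ff qx qy [xy qa] [xa xc ya yc]] := fr.
pose D : {mpoly K[4]} := \sum_j x0 0 j *: q^`M(j).
have DE w : D.@[w 0] = dp q w x0.
  by rewrite /D raddf_sum; apply: eq_bigr => j _; rewrite /= mevalZ mulrC.
apply: (@quadratic_dvd _ _ q U a (x0 + y0) D) => //.
- by rewrite (dpDl hq) xa ya addr0.
- by rewrite (quadD hq) qx qy xy add0r addr0 oner_eq0.
- apply/eqP => D0; have := DE y0; rewrite D0 meval0 (dpC hq) xy => /esym/eqP.
  by rewrite oner_eq0.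
move=> w s; rewrite DE => Dw qw.
have [|s' [t' ->]] := chart_onto qw.
  by rewrite (dpDl hq) (dpZl hq) (dpC hq a) xa mulr0 addr0.
by rewrite (meval_homogZ _ _ hU) -chart_polyE // U0 !horner0 mulr0.
Qed.

Lemma chart_avoid (E : seq 'rV[K]_4) : exists T : seq K, forall s t e k,
  t \notin T -> e \in E -> chart s t <> k *: e.
Proof.
have [ff _ _ _ _] := fr.
elim: E => [|e E [T TE]]; first by exists [::].
have [x [y [z [w eE]]]] := free4_span e ff.
(* Comparing the coordinates along [y0] and [c] gives [k * y = 1] and [t = k * w], so only this
   value of [t] can reach [e]. *)
exists (w / y :: T) => s t e' k; rewrite !inE negb_or => /andP[tw tT].
case/predU1P => [->|]; last exact: TE.
move=> ce; move/eqP: tw; apply.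
have rel : chart s t - k *: e = 0 by rewrite ce subrr.
have [|_ y1 _ w1] := (free4P _ _ _ _ ff)
  (- (s ^+ 2 + s * t * dp q a c + t ^+ 2 * q.@[c 0]) - k * x) (1 - k * y) (s - k * z) (t - k * w).
  by rewrite -[RHS]rel eE; apply/rowP => j; rewrite !mxE; ring.
have y0' : y != 0.
  by apply: contra_eq_neq y1 => ->; rewrite mulr0 subr0 oner_neq0.
move/eqP: w1; rewrite subr_eq0 => /eqP ->.
apply: (mulIf y0'); rewrite mulrAC divfK // -{2}[w]mul1r.
by move/eqP: y1; rewrite subr_eq0 => /eqP <-; rewrite mul1r.
Qed.

Variables (I : finType) (P : pred I) (g : I -> {mpoly K[4]}) (E : seq 'rV[K]_4).
Let F := \prod_(i | P i) g i.
Let avoid v := forall e k, e \in E -> v <> k *: e.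

(* E lists the points, up to a scalar, where the curves g i = 0 on the quadric may
   fail to be reduced, to cross transversally or to lie on B = 0. *)
Lemma adjoint_on_quadric d B :
    F \is d.-homog -> F.@[x0 0] != 0 -> B \is d.-homog ->
    (forall i v b b', P i -> avoid v -> free [:: v; b; b'] -> q.@[v 0] = 0 ->
       dp q v b = 0 -> dp q v b' = 0 -> (g i).@[v 0] = 0 ->
       dp (g i) v b = 0 -> dp (g i) v b' = 0 -> False) ->
    (forall i j v b b', P i -> P j -> i != j -> avoid v -> free [:: v; b; b'] ->
       q.@[v 0] = 0 -> dp q v b = 0 -> dp q v b' = 0 ->
       (g i).@[v 0] = 0 -> (g j).@[v 0] = 0 ->
       dp (g i) v b * dp (g j) v b' = dp (g i) v b' * dp (g j) v b -> False) ->
    (forall i v, P i -> avoid v -> v != 0 -> q.@[v 0] = 0 -> (g i).@[v 0] = 0 -> B.@[v 0] = 0) ->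
  exists beta U, B - beta *: F = U * q.
Proof.
move=> hF Fx0 hB H1 H2 H3; have [T TE] := chart_avoid E.
have av s t : t \notin T -> avoid (chart s t) by move=> tT e k; apply: TE.
have c0 s t : chart s t != 0.
  apply/eqP => cst; have /free3P/(_ 1 0 0)[] := chart_free s t.
    by rewrite cst scaler0 !scale0r !addr0.
  by move/eqP; rewrite oner_eq0.
pose f i := chart_poly (g i).
have FE : chart_poly F = \prod_(i | P i) f i by rewrite /F /chart_poly rmorph_prod.
have [bF topF] := chart_poly_top hF.
have [bB topB] := chart_poly_top hB.
have Fm0 : F.@[(- x0) 0] != 0.
  by rewrite -scaleN1r (meval_homogZ _ _ hF) mulf_neq0 // expf_neq0 // oppr_eq0 oner_eq0.
have f0 i : P i -> f i != 0.
  move=> Pi; apply: contraNneq Fm0 => fi0; move: topF; rewrite FE (bigD1 i) //= fi0 mul0r coef0.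
  by move/esym/eqP; rewrite polyC_eq0.
(* A repeated factor of one [f i], or a common factor of two, would produce a point outside [T]
   forbidden by the first two hypotheses on [g]. *)
have sep : separable_poly (chart_poly F).
  rewrite FE; apply: separable_prod; first exact: index_enum_uniq.
    move=> i Pi; apply/negPn/negP => /(nonseparable_singular T (f0 i Pi)).
    move=> [s [t [tT]]]; rewrite chart_poly_derivY // chart_poly_deriv // chart_polyE //.
    move=> gi d1 d2; have [q1 q2] := chart_tangent s t.
    apply: (H1 i _ _ _ Pi (av s t tT) (chart_free s t) (chart_quadric s t)) => //.
  move=> i j Pi Pj ij; apply/negPn/negP => /(noncoprime_singular T (f0 i Pi) (f0 j Pj)).
  move=> [s [t [tT]]]; rewrite !chart_poly_derivY // !chart_poly_deriv // !chart_polyE //.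
  move=> gi gj dij; have [q1 q2] := chart_tangent s t.
  apply: (H2 i j _ _ _ Pi Pj ij (av s t tT) (chart_free s t) (chart_quadric s t)) => //.
(* This factor cancels the coefficients of the highest power of [s], making the difference smaller
   in size than [chart_poly F]. *)
pose beta := B.@[(- x0) 0] / F.@[(- x0) 0].
exists beta; apply: (@chart_dvd d).
  by rewrite rpredB // rpredZ.
have sF : size (chart_poly F) = (2 * d).+1.
  apply/eqP; rewrite eqn_leq total_degree_le_size // ltnNge.
  apply/negP => /leq_sizeP/(_ _ (leqnn _)).
  by rewrite topF => /eqP; rewrite polyC_eq0 (negPf Fm0).
have CB : chart_poly (B - beta *: F) = chart_poly B - beta%:P%:P * chart_poly F.
  by rewrite /chart_poly mmapB mmapZ.
apply: (separable_vanish (T := T) sep).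
  rewrite CB sF ltnS; apply/leq_sizeP => j; rewrite leq_eqVlt => /predU1P[<-|lj].
    by rewrite coefB coefCM topB topF -polyCM divfK // subrr.
  rewrite coefB coefCM !nth_default ?mulr0 ?subrr //.
    by rewrite (leq_trans (total_degree_le_size bF)).
  by rewrite (leq_trans (total_degree_le_size bB)).
move=> s t tT; rewrite !chart_polyE // mevalB mevalZ => FO.
rewrite FO mulr0 subr0; move: FO; rewrite /F rmorph_prod /= => /eqP/prodf_eq0[i Pi /eqP gi].
exact: (H3 i _ Pi (av s t tT) (c0 s t) (chart_quadric s t)).
Qed.
End Chart.

Lemma ordS_cycle_ind (k : nat) (P : 'I_k -> Prop) (i0 : 'I_k) :
  P i0 -> (forall i, P i -> P (ordS i)) -> forall i, P i.
Proof.
move=> P0 PS; have Piter n : P (iter n (@ordS k) i0).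
  by elim: n => // n IHn; apply: PS.
(* That many steps add [i + k] to 0 modulo [k]. *)
move=> i; have -> : i = iter (i + (k - i0)) (@ordS k) i0; last exact: Piter.
have valiter n : val (iter n (@ordS k) i0) = ((i0 + n) %% k)%N.
  elim: n => [|n IHn]; first by rewrite addn0 modn_small.
  by rewrite iterS /= IHn addnS -[in LHS]addn1 modnDml addn1.
apply/val_inj; rewrite valiter; have := ltn_ord i0; have := ltn_ord i => ik i0k.
have -> : (i0 + (i + (k - i0)) = i + k)%N by lia.
by rewrite modnDr modn_small.
Qed.

(** * Neighbours in a cyclic order *)

Section CyclicOrdinals.
Variables (k : nat) (hk : (3 <= k)%N).
Implicit Types i j r : 'I_k.

Lemma ordS_neq i : ordS i != i.
Proof.
rewrite -val_eqE /=; have := ltn_ord i; rewrite leq_eqVlt => /predU1P[E|ik].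
  by rewrite E modnn; move: E hk; lia.
by rewrite modn_small //; lia.
Qed.

Lemma ordSS_neq i : ordS (ordS i) != i.
Proof.
rewrite -val_eqE /=; have := ltn_ord i; rewrite leq_eqVlt => /predU1P[E|ik].
  by rewrite E modnn modn_small; move: E hk; lia.
rewrite (modn_small ik); have := ik; rewrite leq_eqVlt => /predU1P[E|ik'].
  by rewrite E modnn; move: E hk; lia.
by rewrite modn_small //; lia.
Qed.

Lemma ordS_inj : injective (@ordS k).
Proof. exact: can_inj (@ordSK k). Qed.

Lemma ordS_pred_neq i : ordS i != ord_pred i.
Proof. by apply: contra_neq (ordSS_neq i) => /(congr1 (@ordS k)) ->; rewrite ord_predK. Qed.

Lemma ord_pred_neq i : ord_pred i != i.
Proof. by rewrite -(inj_eq ordS_inj) ord_predK eq_sym ordS_neq. Qed.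

End CyclicOrdinals.

(** The coefficients of [z] form column [i] of the inverse of the matrix with rows [X]. *)
Lemma dual_form (K : numClosedFieldType) n (X : n.-tuple 'rV[K]_n) (i : 'I_n) :
    free X ->
  exists2 z : {mpoly K[n]}, z \is 1.-homog & forall j : 'I_n, z.@[(X`_j) 0] = (i == j)%:R.
Proof.
rewrite free_row_free row_free_unit => uX; set M := \matrix_i _ in uX.
exists (\sum_j (invmx M) j i *: 'X_j).
  by apply: rpred_sum => j _; rewrite rpredZ // dhomogX; apply/eqP/mdeg1.
move=> j; rewrite raddf_sum /=.
transitivity ((row j M *m invmx M) 0 i).
  by rewrite mxE; apply: eq_bigr => m _; rewrite mevalZ mevalXU !mxE mulrC.
by rewrite -row_mul mulmxV // !mxE eq_sym.
Qed.

Lemma dhomog_bigprod (K : numClosedFieldType) n (I : finType) (P : pred I)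
    (f : I -> {mpoly K[n]}) (d : I -> nat) :
  (forall i, P i -> f i \is (d i).-homog) ->
  \prod_(i | P i) f i \is (\sum_(i | P i) d i).-homog.
Proof.
move=> hf; apply: (big_rec2 (fun p m => p \is m.-homog)); first exact: dhomog1.
by move=> i m p Pi hm; apply: dhomogM => //; apply: hf.
Qed.

(** * Rational parametrisation of a conic *)

Section ConicParametrisation.
Variable K : numClosedFieldType.
Variables (a1 a2 e : 'rV[K]_4) (c : K).
Hypotheses (fe : free [:: a1; a2; e]) (c0 : c != 0).
Implicit Types p q : {mpoly K[4]}.

(** Coordinates solving [s * t = c * u ^+ 2]; the only point of the conic missed is [a1]. *)
Definition conic_pt s : 'rV[K]_4 := s ^+ 2 *: a1 + c *: a2 + s *: e.

Definition conic_poly p : {poly K} := mmap (@polyC K)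
  (fun j => a1 0 j *: 'X^2 + (c * a2 0 j)%:P + e 0 j *: 'X) p.

Lemma conic_polyE p s : (conic_poly p).[s] = p.@[(conic_pt s) 0].
Proof.
rewrite -[LHS]/(horner_eval s (conic_poly p)) rmorph_mmap.
  apply: meval_eq => j; rewrite /= /horner_eval !mxE.
  by rewrite !(hornerD, hornerZ, hornerX, hornerXn, hornerC); ring.
by move=> r /=; rewrite /horner_eval hornerC.
Qed.

Lemma conic_pt_neq0 s : conic_pt s != 0.
Proof.
by apply/eqP => /(free3P _ _ _ fe)[_ cz _]; move: c0; rewrite cz eqxx.
Qed.

Lemma conic_pt_avoid (E : seq 'rV[K]_4) : exists T : seq K, forall s b k,
  s \notin T -> b \in E -> conic_pt s <> k *: b.
Proof.
have [f ff] := free_extend fe isT; rewrite /= in ff.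
elim: E => [|b E [T TE]]; first by exists [::].
have [x [y [z [w bE]]]] := free4_span b ff.
(* Proportionality to [b] forces [c = k * y] and [s = k * z]. *)
exists (c * z / y :: T) => s b' k; rewrite !inE negb_or => /andP[sz sT].
case/predU1P => [->|]; last exact: TE.
move=> ce; move/eqP: sz; apply.
have [|_ y1 z1 _] := (free4P _ _ _ _ ff) (s ^+ 2 - k * x) (c - k * y) (s - k * z) (- k * w).
  have <- : conic_pt s - k *: b = 0 by rewrite ce subrr.
  by rewrite bE; apply/rowP => j; rewrite !mxE; ring.
have ck : c = k * y by apply/eqP; rewrite -subr_eq0 y1.
have sk : s = k * z by apply/eqP; rewrite -subr_eq0 z1.
have y0 : y != 0 by apply: contraNneq c0 => y0; rewrite ck y0 mulr0.
by rewrite sk ck mulrAC mulfK.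
Qed.

End ConicParametrisation.

(** * Cycles of quadrics *)

Section CycleData.
Variables (K : numClosedFieldType) (k : nat).
Variables (S : 'I_k -> {mpoly K[4]}) (C : 'I_k -> set (P3 K)) (v1 v2 : P3 K).
Hypothesis hS : cycle_of_quadrics S C v1 v2.
Implicit Types i j r : 'I_k.
Local Notation a1 := (hvec v1).
Local Notation a2 := (hvec v2).

(** With this scaling, quadrics containing the same edge conic restrict to the same form on its
    plane. *)
Definition norm_quadric i := (dp (S i) a1 a2)^-1 *: S i.
Local Notation Q := norm_quadric.

Lemma cycle_frames : exists l e c, forall i, conic_frame (C i) a1 a2 (l i) (e i) (c i).
Proof.
have /choice[f fP] i : exists lec, conic_frame (C i) a1 a2 lec.1.1 lec.1.2 lec.2.
  have [Ci1 Ci2] := cq_conics_poles hS i.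
  have [l [e [c H]]] := conic_frame_exists (cq_conics hS i) (cq_poles_distinct hS) Ci1 Ci2.
  by exists (l, e, c).
by exists (fun i => (f i).1.1), (fun i => (f i).1.2), (fun i => (f i).2).
Qed.

Lemma quadric_homog i : S i \is 2.-homog.
Proof. by case: (cq_quadrics hS i) => [[]]. Qed.

Lemma edge_sub i : (C i `<=` zeros (S i))%classic.
Proof. by move=> x /(cq_edges hS)[]. Qed.

Lemma edge_subS i : (C i `<=` zeros (S (ordS i)))%classic.
Proof. by move=> x /(cq_edges hS)[]. Qed.

Lemma polar_neq0 i : dp (S i) a1 a2 != 0.
Proof.
have [l [e [c cf]]] := cycle_frames.
exact: quadric_on_conic_neq0 (cf i) (cq_quadrics hS i) (@edge_sub i).
Qed.

Lemma norm_quadric_homog i : Q i \is 2.-homog.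
Proof. by rewrite rpredZ // quadric_homog. Qed.

Lemma norm_quadricK i : S i = dp (S i) a1 a2 *: Q i.
Proof. by rewrite /Q scalerA divff ?scale1r // polar_neq0. Qed.

Lemma norm_quadric_zero i (v : 'rV_4) : (Q i).@[v 0] = 0 <-> (S i).@[v 0] = 0.
Proof.
rewrite mevalZ; split=> [/eqP|->]; last by rewrite mulr0.
by rewrite mulf_eq0 invr_eq0 (negPf (polar_neq0 i)) => /eqP.
Qed.

Lemma norm_quadric_nonsingular i : nonsingular_quadric (Q i).
Proof.
have b0 := polar_neq0 i; have [[S0 _] Sg] := cq_quadrics hS i.
split=> [|x Qx].
  by split; [rewrite scaler_eq0 invr_eq0 (negPf b0) | exact: norm_quadric_homog].
have Sx : zeros (S i) x by apply/(norm_quadric_zero i (hvec x)).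
apply: contraNneq (Sg x Sx) => gQ; apply/eqP/rowP => j.
have := congr1 (fun u : 'rV_4 => u 0 j) gQ; rewrite !mxE mderivZ mevalZ => /eqP.
by rewrite mulf_eq0 invr_eq0 (negPf b0) => /eqP.
Qed.

Lemma norm_quadric_on_conic r j l e c : conic_frame (C r) a1 a2 l e c ->
    (C r `<=` zeros (S j))%classic ->
  forall s t u, (Q j).@[(s *: a1 + t *: a2 + u *: e) 0] = s * t - c * u ^+ 2.
Proof.
move=> cf sub s t u.
by rewrite mevalZ (quadric_on_conic cf (quadric_homog j) sub) mulKf // polar_neq0.
Qed.

(** The two normalised quadrics through an edge agree on its plane, so [l i] divides their
    difference. *)
Lemma cycle_residual_planes (l : 'I_k -> {mpoly K[4]}) e c :
    (forall i, conic_frame (C i) a1 a2 (l i) (e i) (c i)) ->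
  exists m, forall i, m i \is 1.-homog /\ Q (ordS i) = Q i + m i * l i.
Proof.
move=> cf; suff H i : exists m, m \is 1.-homog /\ Q (ordS i) = Q i + m * l i.
  by have [m mP] := choice H; exists m.
have [[l0 hl] [la1 la2 le _] fe span _] := cf i.
have [f lf] := mpoly_vector_nonroot l0.
pose v := (l i).@[f 0]^-1 *: f.
have lv : (l i).@[v 0] = 1 by rewrite (meval_homogZ _ _ hl) expr1 mulVf.
have [|x s _ lx|m mE] := @linear_dvd _ _ (l i) (Q (ordS i) - Q i) v 1 hl lv.
- exact: oner_neq0.
- have [s' [t' [u' ->]]] := span _ lx.
  rewrite mevalB (norm_quadric_on_conic (cf i) (@edge_sub i)).
  by rewrite (norm_quadric_on_conic (cf i) (@edge_subS i)) subrr.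
exists m; split; last by rewrite -mE addrC subrK.
apply: (dhomog_mulr l0 hl); rewrite mulrC -mE.
by rewrite rpredB // norm_quadric_homog.
Qed.

End CycleData.

Lemma finite_hvec (K : numClosedFieldType) (X : set (P3 K)) : finite_set X ->
  exists E : seq 'rV[K]_4, forall x, X x -> hvec x \in E.
Proof.
move=> /(finite_image (@hvec K))/finite_seqP[E EE]; exists E => x Xx.
have : ((@hvec K) @` X)%classic (hvec x) by exists x.
by rewrite EE.
Qed.

(** * Edge conics, residual curves and the exceptional points *)

Section Cycle.
Variables (K : numClosedFieldType) (k : nat) (hk : (3 <= k)%N).
Variables (S : 'I_k -> {mpoly K[4]}) (C : 'I_k -> set (P3 K)) (v1 v2 : P3 K).
Hypothesis hS : cycle_of_quadrics S C v1 v2.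
Local Notation a1 := (hvec v1).
Local Notation a2 := (hvec v2).
Local Notation Q := (norm_quadric S v1 v2).
Variables (l : 'I_k -> {mpoly K[4]}) (e : 'I_k -> 'rV[K]_4) (c : 'I_k -> K).
Variable (m : 'I_k -> {mpoly K[4]}).
Hypothesis cf : forall i, conic_frame (C i) a1 a2 (l i) (e i) (c i).
Hypothesis mP : forall i, m i \is 1.-homog /\ Q (ordS i) = Q i + m i * l i.
Implicit Types (i j r : 'I_k) (v w b : 'rV[K]_4) (x : P3 K).
Local Notation pt r := (conic_pt a1 a2 (e r) (c r)).

Let hQ i : Q i \is 2.-homog. Proof. exact: (norm_quadric_homog hS). Qed.
Let hm i : m i \is 1.-homog. Proof. by case: (mP i). Qed.
Let QS i : Q (ordS i) = Q i + m i * l i. Proof. by case: (mP i). Qed.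
Let hl i : l i \is 1.-homog. Proof. by case: (cf i) => [[]]. Qed.
Let c0 i : c i != 0. Proof. by case: (cf i) => [_ []]. Qed.
Let fe i : free [:: a1; a2; e i]. Proof. by case: (cf i). Qed.

Lemma zeros_norm i x : zeros (S i) x <-> (Q i).@[hvec x 0] = 0.
Proof. by split=> H; apply/(norm_quadric_zero hS i (hvec x)). Qed.

Lemma zeros_scale d (p : {mpoly K[4]}) x s v : p \is d.-homog -> s != 0 ->
  hvec x = s *: v -> zeros p x <-> p.@[v 0] = 0.
Proof.
move=> hp s0 xv; rewrite /zeros /= -[hcoord x]/(hvec x 0) xv (meval_homogZ _ _ hp).
split=> [/eqP|->]; last by rewrite mulr0.
by rewrite mulf_eq0 expf_eq0 (negPf s0) andbF => /eqP.
Qed.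

Lemma plane_conic i x : (l i).@[hvec x 0] = 0 -> (Q i).@[hvec x 0] = 0 -> C i x.
Proof.
have [_ _ _ span CE] := cf i; move=> /span[s [t [u xE]]].
rewrite xE (norm_quadric_on_conic hS (cf i) (edge_sub hS (i := i))) => /eqP.
by rewrite subr_eq0 => /eqP st; apply/CE; exists s, t, u.
Qed.

Lemma conic_pt_mem i x s t : t != 0 -> hvec x = t *: pt i s -> C i x.
Proof.
have [_ _ _ _ CE] := cf i; move=> t0 xE; apply/CE.
exists (t * s ^+ 2), (t * c i), (t * s); split; last by ring.
by rewrite xE /conic_pt !scalerDr !scalerA.
Qed.

Lemma conic_quadrics i s : (Q i).@[pt i s 0] = 0 /\ (Q (ordS i)).@[pt i s 0] = 0.
Proof.
rewrite /conic_pt (norm_quadric_on_conic hS (cf i) (edge_sub hS (i := i))).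
by rewrite (norm_quadric_on_conic hS (cf i) (edge_subS hS (i := i))); split; ring.
Qed.

Lemma conic_plane i s : (l i).@[pt i s 0] = 0.
Proof.
have [_ [l1 l2 l3 _] _ _ _] := cf i.
by rewrite /conic_pt linear_eval3 // l1 l2 l3 !mulr0 !addr0.
Qed.

Lemma conic_mem_pt i x : C i x -> x = v1 \/ exists s t, hvec x = t *: pt i s.
Proof.
have [_ _ _ _ CE] := cf i; move/CE => [s [t [u [xE st]]]].
have [t0|t0] := eqVneq t 0; [left|right].
  have u0 : u = 0.
    apply/eqP; move/eqP: st; rewrite t0 mulr0 eq_sym mulf_eq0 expf_eq0 /=.
    by rewrite (negPf (c0 i)).
  by apply: (@hvec_inj _ _ _ s); rewrite xE t0 u0 !scale0r !addr0.
exists (u * c i / t), (t / c i); rewrite xE /conic_pt !scalerDr !scalerA.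
have -> : s = c i * u ^+ 2 / t by rewrite -st mulfK.
congr (_ *: _ + _ *: _ + _ *: _); field; by rewrite ?t0 ?c0.
Qed.

Lemma conic_point_neq_poles i x s t : s != 0 -> hvec x = t *: pt i s -> x <> v1 /\ x <> v2.
Proof.
move=> s0 xE; have t0 : t != 0.
  by apply: contraNneq (hvec_neq0 x) => t0; rewrite xE t0 scale0r.
split=> xv; move: xE; rewrite xv => vE.
  have [|_ _ /eqP] := (free3P _ _ _ (fe i)) (t * s ^+ 2 - 1) (t * c i) (t * s).
    have <- : t *: pt i s - a1 = 0 by rewrite -vE subrr.
    by apply/rowP => j; rewrite !mxE; ring.
  by rewrite mulf_eq0 (negPf t0) (negPf s0).
have [|_ _ /eqP] := (free3P _ _ _ (fe i)) (t * s ^+ 2) (t * c i - 1) (t * s).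
  have <- : t *: pt i s - a2 = 0 by rewrite -vE subrr.
  by apply/rowP => j; rewrite !mxE; ring.
by rewrite mulf_eq0 (negPf t0) (negPf s0).
Qed.

Lemma triple_ordinary x i j r : uniq [:: i; j; r] -> x <> v1 -> x <> v2 ->
    zeros (S i) x -> zeros (S j) x -> zeros (S r) x ->
  free [:: gradient (S i) x; gradient (S j) x; gradient (S r) x].
Proof.
move=> u3 x1 x2 Si Sj Sr.
have [si sj sr] : [/\ i \in sheets S x, j \in sheets S x & r \in sheets S x].
  by split; rewrite inE; apply/eqP.
have /= [|[_ ordx]] := cq_triple hS x1 x2; last exact: ordx.
have : (#|[:: i; j; r]| <= #|sheets S x|)%N.
  apply: subset_leq_card; apply/fintype.subsetP => y; rewrite !inE.
  by move=> /or3P[] /eqP ->.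
by rewrite (card_uniqP u3) => /leq_trans H /H.
Qed.

Lemma dp_scale_vec i t v y : dp (S i) (t *: v) y = dp (S i) a1 a2 * t * dp (Q i) v y.
Proof. by rewrite {1}(norm_quadricK hS i) dpZ (dpZl (hQ i)) mulrA. Qed.

(* Otherwise the tangent line of the conic would lie in three tangent planes at an
   ordinary triple point. *)
Lemma edge_not_in_third r j : j != r -> j != ordS r -> conic_poly a1 a2 (e r) (c r) (Q j) != 0.
Proof.
move=> jr jSr; apply/eqP => Q0.
have Qpt s : (Q j).@[pt r s 0] = 0 by rewrite -conic_polyE Q0 horner0.
have sub : (C r `<=` zeros (S j))%classic.
  move=> x /conic_mem_pt[->|[s [t xE]]].
    by have /(_ j) := cq_common hS (or_introl (erefl v1)); apply.
  by apply/zeros_norm; rewrite xE (quadZ (hQ j)) Qpt mulr0.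
(* [b] is the velocity of the parametrisation at parameter 1, so it spans with [v] the tangent line
   of the conic. *)
pose v := pt r 1; pose b : 'rV[K]_4 := 2%:R *: a1 + 0 *: a2 + 1 *: e r.
have tangent i : (C r `<=` zeros (S i))%classic -> dp (Q i) v b = 0 /\ dp (Q i) v v = 0.
  move=> subi; have QE := norm_quadric_on_conic hS (cf r) subi.
  have vb : dp (Q i) v b = (Q i).@[(v + b) 0] - (Q i).@[v 0] - (Q i).@[b 0].
    by rewrite (quadD (hQ i)); ring.
  have vbE : v + b = 3%:R *: a1 + c r *: a2 + 2%:R *: e r.
    by rewrite /v /b /conic_pt; apply/rowP => y; rewrite !mxE; ring.
  split; last by rewrite (dp_diag (hQ i)) /v /conic_pt QE; ring.
  by rewrite vb vbE /v /b /conic_pt !QE; ring.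
have [x [t t0 xE]] := point_of (conic_pt_neq0 (fe r) (c0 r) 1).
have [x1 x2] := conic_point_neq_poles (oner_neq0 _) xE.
have Cx := conic_pt_mem t0 xE.
have u3 : uniq [:: r; ordS r; j].
  by rewrite /= !inE negb_or eq_sym ordS_neq //= ![_ == j]eq_sym jr jSr.
have f3 := triple_ordinary u3 x1 x2 (edge_sub hS Cx) (edge_subS hS Cx) (sub _ Cx).
have fvb : free [:: v; b].
  apply/free2P => s u su.
  have [|s0 _ su0] := (free3P _ _ _ (fe r)) (s + 2%:R * u) (s * c r) (s + u).
    by rewrite -[RHS]su /v /b /conic_pt; apply/rowP => y; rewrite !mxE; ring.
  have u0 : u = 0.
    transitivity ((s + 2%:R * u) - (s + u)); first by ring.
    by rewrite s0 su0 subr0.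
  by split=> //; move: s0; rewrite u0 mulr0 addr0.
have := @free_annihilated _ 4 3 2
  [tuple gradient (S r) x; gradient (S (ordS r)) x; gradient (S j) x] [tuple v; b] f3 fvb.
move=> H; suff : (3 + 2 <= 4)%N by []. apply: H.
have kill i : (C r `<=` zeros (S i))%classic -> forall y : 'I_2,
    gradient (S i) x *m ([tuple v; b]`_y)^T = 0.
  move=> subi y; have [tb tv] := tangent i subi.
  rewrite gradient_dp xE dp_scale_vec.
  by case: y => -[|[|y]] // ?; rewrite /= ?tb ?tv mulr0 raddf0.
by case=> -[|[|[|y]]] // ? y'; apply: kill;
  [exact: (edge_sub hS) | exact: (edge_subS hS) | exact: sub].
Qed.

(** Where [l r] and [m r] both vanish, their product has zero gradient and the two normalised
    quadrics have the same gradient. *)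
Lemma not_transverse_edge r x : (l r).@[hvec x 0] = 0 -> (m r).@[hvec x 0] = 0 ->
  ~~ transverse_at (S r) (S (ordS r)) x.
Proof.
move=> lx mx; apply/negP => /free2P H.
have [|_ /eqP] := H (- (dp (S r) a1 a2)^-1) (dp (S (ordS r)) a1 a2)^-1.
  apply/rowP => j; rewrite !mxE.
  have := congr1 (fun p : {mpoly K[4]} => (p^`M(j)).@[hvec x 0]) (QS r).
  rewrite mderivD mderivM !mevalD !mevalM lx mx mulr0 mul0r !addr0 !mderivZ !mevalZ => ->.
  by rewrite mulNr addNr.
by rewrite invr_eq0 (negPf (polar_neq0 hS _)).
Qed.

(* Otherwise the two quadrics would be tangent along the whole conic. *)
Lemma residual_plane_not_through_edge r : conic_poly a1 a2 (e r) (c r) (m r) != 0.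
Proof.
apply/eqP => m0; have mpt s : (m r).@[pt r s 0] = 0 by rewrite -conic_polyE m0 horner0.
have [E HE] : exists E : seq 'rV[K]_4, forall x,
    zeros (S r) x -> zeros (S (ordS r)) x -> ~~ transverse_at (S r) (S (ordS r)) x -> hvec x \in E.
  have := cq_double hS (i := r) (j := ordS r); rewrite eq_sym ordS_neq // => /(_ isT)/finite_hvec.
  by move=> [E HE]; exists E => x Sx SSx tx; apply: HE.
have [T TE] := conic_pt_avoid (fe r) (c0 r) E.
have [s sT _] := nonroot_notin T (oner_neq0 {poly K}).
have [x [t t0 xE]] := point_of (conic_pt_neq0 (fe r) (c0 r) s).
have [Q1 Q2] := conic_quadrics r s.
apply: (TE s (hvec x) t^-1 sT); last by rewrite xE scalerA mulVf // scale1r.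
apply: HE.
- by apply/(zeros_norm); rewrite xE (quadZ (hQ _)) Q1 mulr0.
- by apply/(zeros_norm); rewrite xE (quadZ (hQ _)) Q2 mulr0.
apply: not_transverse_edge.
  by rewrite xE (meval_homogZ _ _ (hl r)) (conic_plane) mulr0.
by rewrite xE (meval_homogZ _ _ (hm r)) mpt mulr0.
Qed.

(** Neither the residual plane nor a third quadric contains the edge, so these points are given by
    the roots of one nonzero polynomial. The pole [a1], which the parametrisation misses, is listed
    separately. *)
Lemma conic_bad_points r : exists E : seq 'rV[K]_4, forall x, C r x ->
    (m r).@[hvec x 0] = 0 \/ (exists j, [/\ j != r, j != ordS r & (Q j).@[hvec x 0] = 0]) ->
  exists2 b, b \in E & exists t, hvec x = t *: b.
Proof.
pose f p := conic_poly a1 a2 (e r) (c r) p.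
pose p := f (m r) * \prod_(j | (j != r) && (j != ordS r)) f (Q j).
have p0 : p != 0.
  rewrite mulf_neq0 ?residual_plane_not_through_edge //; apply/prodf_neq0 => j /andP[jr jSr].
  exact: (edge_not_in_third).
have [R pE] := closed_field_poly_normal p.
exists (a1 :: [seq pt r s | s <- R]) => x /(conic_mem_pt)[->|[s [t xE]]] bad.
  by exists a1; rewrite ?mem_head //; exists 1; rewrite scale1r.
have t0 : t != 0 by apply: contraNneq (hvec_neq0 x) => t0; rewrite xE t0 scale0r.
exists (pt r s); last by exists t.
rewrite inE map_f ?orbT //.
have : root p s.
  rewrite /p rootM /root horner_prod; case: bad => [mx|[j [jr jSr Qx]]].
    move: mx; rewrite xE (meval_homogZ _ _ (hm r)) => /eqP.
    by rewrite mulf_eq0 expf_eq0 (negPf t0) andbF -conic_polyE => /= ->.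
  apply/orP; right; apply/prodf_eq0; exists j; first by rewrite jr.
  move: Qx; rewrite xE (quadZ (hQ j)) => /eqP; rewrite mulf_eq0 expf_eq0 (negPf t0) andbF.
  by rewrite -conic_polyE.
by rewrite pE rootZ ?lead_coef_eq0 // root_prod_XsubC.
Qed.

(* The residual part of the intersection of the quadrics i and j is cut out on the
   quadric i by [residual_form i j]. *)
Definition residual_form i j :=
  if j == ordS i then m i else if j == ord_pred i then m (ord_pred i) else Q j.
Local Notation g := residual_form.
Definition residual_prod i := \prod_(j | j != i) g i j.
Local Notation F := residual_prod.

(** Two factors are planes and the other [k - 3] are quadrics; the two neighbours of [i] are
    distinct because [k] is at least 3. *)
Lemma residual_prod_homog i : F i \is (2 * k - 4).-homog.
Proof.
pose d j := if (j == ordS i) || (j == ord_pred i) then 1%N else 2%N.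
have -> : (2 * k - 4 = \sum_(j | j != i) d j)%N.
  have : (\sum_(j < k) 2 = 2 * k)%N by rewrite sum_nat_const card_ord mulnC.
  rewrite (bigD1 i) //= (bigD1 (ordS i)) ?ordS_neq //= => E.
  rewrite (bigD1 (ordS i)) ?ordS_neq //=.
  have pi : (ord_pred i != i) && (ord_pred i != ordS i).
    by rewrite ord_pred_neq // eq_sym ordS_pred_neq.
  move: E; rewrite (bigD1 (ord_pred i)) //= => E.
  rewrite (bigD1 (ord_pred i)) //= {1 2}/d !eqxx orbT /=.
  rewrite (eq_bigr (fun=> 2%N)) => [|j /andP[/andP[_ j1] j2]]; last first.
    by rewrite /d (negPf j1) (negPf j2).
  by rewrite -E; lia.
apply: dhomog_bigprod => j _; rewrite /g /d.
by case: eqP => _ /=; [exact: hm | case: eqP => _ /=; [exact: hm | exact: hQ]].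
Qed.

(** Up to adding [Q i], [Q j] is a multiple of [g i j]. By the product rule, tangency of [g i j]
    with quadric [i] passes to quadric [j]. *)
Lemma residual_form_zero i j v : j != i -> (Q i).@[v 0] = 0 -> (g i j).@[v 0] = 0 ->
  (Q j).@[v 0] = 0 /\
  exists s t, forall y, dp (Q j) v y = s * dp (Q i) v y + t * dp (g i j) v y.
Proof.
move=> ji Qv; rewrite /g; case: eqP => [->|_].
  move=> mv; split; first by rewrite QS mevalD mevalM Qv mv mul0r addr0.
  exists 1, (l i).@[v 0] => y; rewrite QS dpD dpM mv; ring.
case: eqP => [->|_] gv.
  set p := ord_pred i; have QE : Q i = Q p + m p * l p by rewrite -QS ord_predK.
  split; first by move: Qv; rewrite QE mevalD mevalM gv mul0r addr0.
  by exists 1, (- (l p).@[v 0]) => y; rewrite QE dpD dpM gv; ring.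
by split=> //; exists 0, 1 => y; ring.
Qed.

Lemma residual_form_nonzero_edge i s : s != 0 ->
  (conic_poly a1 a2 (e i) (c i) (m i)).[s] != 0 ->
  (forall j, j != i -> j != ordS i -> (Q j).@[pt i s 0] != 0) ->
  (F i).@[pt i s 0] != 0 /\ (F (ordS i)).@[pt i s 0] != 0.
Proof.
rewrite conic_polyE => s0 ms Qs; have [Qi QSi] := conic_quadrics i s.
split; rewrite rmorph_prod; apply/prodf_neq0 => j ji; apply/eqP => gj.
  have [Qj _] := residual_form_zero ji Qi gj.
  have [jS|jS] := eqVneq j (ordS i); last by move: (Qs j ji jS); rewrite Qj eqxx.
  by move: gj; rewrite /= /g jS eqxx => /eqP; rewrite (negPf ms).
have [Qj _] := residual_form_zero ji QSi gj.
have [jS|jS] := eqVneq j i; last by move: (Qs j jS ji); rewrite Qj eqxx.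
(* Seen from [ordS i], index [i] must be the predecessor and not also the successor, which holds for
   at least three quadrics. *)
move: gj; rewrite /= /g jS ordSK eqxx eq_sym.
by rewrite (negPf (ordSS_neq hk i)) => /eqP; rewrite (negPf ms).
Qed.

(** All the conditions amount to one product of nonzero polynomials in the parameter not
    vanishing. *)
Lemma generic_edge_param i (P : {poly K}) : P != 0 -> exists s,
  [/\ s != 0, P.[s] != 0, (conic_poly a1 a2 (e i) (c i) (m i)).[s] != 0 &
      forall j, j != i -> j != ordS i -> (Q j).@[pt i s 0] != 0].
Proof.
move=> P0; pose f p := conic_poly a1 a2 (e i) (c i) p.
have [|s] := @poly_nonroot K ('X * P * f (m i) * \prod_(j | (j != i) && (j != ordS i)) f (Q j)).
  rewrite !mulf_neq0 ?polyX_eq0 ?residual_plane_not_through_edge //.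
  by apply/prodf_neq0 => j /andP[ji jS]; apply: (edge_not_in_third).
rewrite !hornerM hornerX horner_prod !mulf_eq0 !negb_or -!andbA => /and4P[s0 Ps ms Qs].
exists s; split=> // j ji jS; rewrite -conic_polyE.
by move/prodf_neq0: Qs; apply; rewrite ji.
Qed.

(** * Adjoints restricted to one quadric *)

Local Notation N := (2 * k - 4)%N.

(** The set [residual] omits the edge conics entirely, so a point of a residual curve lying on an
    edge must be recognised as an exceptional point of that edge. *)
Lemma point_residual x (B : {mpoly K[4]}) i j :
    (residual S C `<=` zeros B)%classic -> j != i ->
    (Q i).@[hvec x 0] = 0 -> (g i j).@[hvec x 0] = 0 ->
  B.@[hvec x 0] = 0 \/ exists r, C r x /\ ((m r).@[hvec x 0] = 0 \/
    exists j, [/\ j != r, j != ordS r & (Q j).@[hvec x 0] = 0]).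
Proof.
move=> resB ji Qi gj; have [Qj _] := residual_form_zero ji Qi gj.
have [[r Cr]|noC] := pselect (exists r, C r x); [right|left].
  exists r; split=> //.
  have [ir|ir] := eqVneq i r.
    have [jS|jS] := eqVneq j (ordS r).
      by left; move: gj; rewrite /residual_form ir jS eqxx.
    by right; exists j; rewrite -{1}ir.
  have [iS|iS] := eqVneq i (ordS r); last by right; exists i.
  have [jr|jr] := eqVneq j r; last by right; exists j; rewrite -iS.
  left; move: gj; rewrite /residual_form jr iS ordSK eqxx.
  by rewrite eq_sym (negPf (ordSS_neq hk r)).
apply: resB; split=> //; exists i, j; split; first by rewrite eq_sym.
  exact/(zeros_norm).
exact/(zeros_norm).
Qed.

Lemma adjoint_mod_quadric i (B : {mpoly K[4]}) :
    B \is N.-homog -> (residual S C `<=` zeros B)%classic ->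
  (* The chart is centred at a generic point of edge [i], where [F i] is nonzero, so that [F i]
     keeps its full degree there. *)
  exists beta U, B - beta *: F i = U * Q i.
Proof.
move=> hB resB; have [s [s0 _ ms Qs]] := generic_edge_param i (oner_neq0 _).
have [Fs _] := residual_form_nonzero_edge s0 ms Qs.
have [Qi _] := conic_quadrics i s.
have [y0 [a [b fr]]] := quadric_frame_exists (norm_quadric_nonsingular hS i)
  (conic_pt_neq0 (fe i) (c0 i) s) Qi.
have /choice[E1 E1P] j : exists E : seq 'rV[K]_4, forall x, i != j ->
    zeros (S i) x -> zeros (S j) x -> ~~ transverse_at (S i) (S j) x -> hvec x \in E.
  have [_|ij] := eqVneq i j; first by exists [::].
  have [E EP] := finite_hvec (cq_double hS ij).
  by exists E => x _ Si Sj tr; apply: EP.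
have /choice[E2 E2P] := conic_bad_points.
(* The poles, the points where quadric [i] is tangent to another one, and the exceptional points of
   the edges. *)
pose E := a1 :: a2 :: flatten [seq E1 j | j <- enum 'I_k] ++ flatten [seq E2 j | j <- enum 'I_k].
have inE1 j w : w \in E1 j -> w \in E.
  move=> wE; rewrite !inE mem_cat; apply/or3P/Or33; apply/orP; left.
  by apply/flatten_mapP; exists j; rewrite ?mem_enum.
have inE2 j w : w \in E2 j -> w \in E.
  move=> wE; rewrite !inE mem_cat; apply/or3P/Or33; apply/orP; right.
  by apply/flatten_mapP; exists j; rewrite ?mem_enum.
have avoidE v x t w u : (forall w u, w \in E -> v <> u *: w) -> t != 0 -> hvec x = t *: v ->
    w \in E -> hvec x = u *: w -> False.
  move=> av t0 xE wE xw; apply: (av w (u / t) wE).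
  by apply: (scalerI t0); rewrite -xE xw scalerA mulrC divfK.
have free_neq0 v w w' : free [:: v; w; w'] -> v != 0.
  move=> fv; apply/eqP => v0; have [|/eqP] := (free3P _ _ _ fv) 1 0 0.
    by rewrite v0 scaler0 !scale0r !addr0.
  by rewrite oner_eq0.
apply: (adjoint_on_quadric (hQ i) fr (I := 'I_k) (P := fun j => j != i) (g := g i) (E := E)
  (residual_prod_homog i) Fs hB).
(* A tangency of [g i j] with quadric [i] makes quadrics [i] and [j] tangent, which happens only at
   points of [E]. *)
- move=> j v w w' ji av fv Qv qw qw' gv gw gw'.
  have [x [t t0 xE]] := point_of (free_neq0 _ _ _ fv).
  have [Qj [s' [t' dE]]] := residual_form_zero ji Qv gv.
  apply: (avoidE v x t (hvec x) 1 av t0 xE); last by rewrite scale1r.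
  apply: (inE1 j); apply: E1P; first by rewrite eq_sym.
  + by apply/(zeros_norm); rewrite xE (quadZ (hQ _)) Qv mulr0.
  + by apply/(zeros_norm); rewrite xE (quadZ (hQ _)) Qj mulr0.
  have vv : dp (Q i) v v = 0 /\ dp (Q j) v v = 0 by rewrite !dp_diag // Qv Qj mulr0.
  apply: (not_transverse_at fv) => y; rewrite xE (dp_scale_vec) !inE => /or3P[] /eqP ->.
  + by rewrite vv.1 mulr0.
  + by rewrite qw mulr0.
  + by rewrite qw' mulr0.
  + by rewrite vv.2 mulr0.
  + by rewrite dE qw gw !mulr0 addr0 mulr0.
  + by rewrite dE qw' gw' !mulr0 addr0 mulr0.
(* Three quadrics meet here away from the poles, so their gradients are independent; a tangency of
   two residual curves contradicts this. *)
- move=> j r v w w' ji ri jr av fv Qv qw qw' gj gr jac.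
  have [x [t t0 xE]] := point_of (free_neq0 _ _ _ fv).
  have [Qj [sj [tj dj]]] := residual_form_zero ji Qv gj.
  have [Qr [sr [tr dr]]] := residual_form_zero ri Qv gr.
  have Sx n : (Q n).@[v 0] = 0 -> zeros (S n) x.
    by move=> Qn; apply/(zeros_norm); rewrite xE (quadZ (hQ _)) Qn mulr0.
  have xv1 : x <> v1.
    by move=> xv; apply: (avoidE v x t a1 1 av t0 xE); rewrite ?inE ?eqxx // xv scale1r.
  have xv2 : x <> v2.
    by move=> xv; apply: (avoidE v x t a2 1 av t0 xE); rewrite ?inE ?eqxx ?orbT // xv scale1r.
  have u3 : uniq [:: i; j; r] by rewrite /= !inE negb_or ![i == _]eq_sym ji ri jr.
  have f3 := triple_ordinary u3 xv1 xv2 (Sx i Qv) (Sx j Qj) (Sx r Qr).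
  have jacQ : dp (Q j) v w * dp (Q r) v w' = dp (Q j) v w' * dp (Q r) v w.
    rewrite !dj !dr qw qw' !mulr0 !add0r mulrACA jac; ring.
  (* The vanishing Jacobian determinant yields a nontrivial combination of the two gradients killing
     [w] and [w']. *)
  have [al [be [albe kw kw']]] : exists al be, [/\ (al != 0) || (be != 0),
      al * dp (S j) (hvec x) w + be * dp (S r) (hvec x) w = 0 &
      al * dp (S j) (hvec x) w' + be * dp (S r) (hvec x) w' = 0].
    have jacS : dp (S j) (hvec x) w * dp (S r) (hvec x) w' =
                dp (S j) (hvec x) w' * dp (S r) (hvec x) w.
      rewrite xE !(dp_scale_vec) mulrACA jacQ; ring.
    have [z1|nz1] := eqVneq (dp (S r) (hvec x) w) 0; last first.
      exists (dp (S r) (hvec x) w), (- dp (S j) (hvec x) w); rewrite nz1; split=> //; first by ring.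
      by rewrite mulrC -jacS; ring.
    have [z2|nz2] := eqVneq (dp (S r) (hvec x) w') 0.
      by exists 0, 1; rewrite oner_eq0 orbT z1 z2; split=> //; ring.
    have z3 : dp (S j) (hvec x) w = 0.
      by apply: (mulIf nz2); rewrite jacS z1 mulr0 mul0r.
    exists (dp (S r) (hvec x) w'), (- dp (S j) (hvec x) w'); rewrite nz2 z1 z3; split=> //; ring.
  pose G := al *: gradient (S j) x + be *: gradient (S r) x.
  have fG : free [:: gradient (S i) x; G].
    apply/free2P => s' t' st.
    have [|s0' /eqP ta /eqP tb] := (free3P _ _ _ f3) s' (t' * al) (t' * be).
      by rewrite -[RHS]st /G scalerDr !scalerA addrA.
    split=> //; apply/eqP; move: ta tb; rewrite !mulf_eq0.
    by case: (t' == 0) => //= /eqP al0 /eqP be0; move: albe; rewrite al0 be0 eqxx.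
  suff : (2 + 3 <= 4)%N by [].
  apply: (@free_annihilated _ 4 2 3 [tuple gradient (S i) x; G] [tuple v; w; w'] fG fv).
  have killS n : (Q n).@[v 0] = 0 -> dp (S n) (hvec x) v = 0.
    by move=> Qn; rewrite xE (dp_scale_vec) (dp_diag (hQ _)) Qn !mulr0.
  have killi y : dp (Q i) v y = 0 -> dp (S i) (hvec x) y = 0.
    by move=> Qy; rewrite xE (dp_scale_vec) Qy mulr0.
  case=> -[|[|n]] // ? [[|[|[|n']]] // ?]; rewrite /G ?mulmxDl -?scalemxAl !gradient_dp /=.
  + by rewrite killS // raddf0.
  + by rewrite killi // raddf0.
  + by rewrite killi // raddf0.
  + by rewrite !killS // raddf0 !scaler0 addr0.
  + by rewrite !scale_scalar_mx -raddfD /= kw raddf0.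
  + by rewrite !scale_scalar_mx -raddfD /= kw' raddf0.
(* Off the edges the point belongs to [residual]; on an edge it would be listed in [E]. *)
- move=> j v ji av v0 Qv gv.
  have [x [t t0 xE]] := point_of v0.
  have Qx : (Q i).@[hvec x 0] = 0 by rewrite xE (quadZ (hQ _)) Qv mulr0.
  have gx : (g i j).@[hvec x 0] = 0.
    have hg : exists d, g i j \is d.-homog.
      rewrite /residual_form; case: eqP => _; first by exists 1%N; apply: hm.
      by case: eqP => _; [exists 1%N; apply: hm | exists 2%N; apply: hQ].
    by have [d hd] := hg; rewrite xE (meval_homogZ _ _ hd) gv mulr0.
  have [|[r [Cr bad]]] := point_residual resB ji Qx gx.
    by rewrite xE (meval_homogZ _ _ hB) => /eqP; rewrite mulf_eq0 expf_eq0 (negPf t0) andbF => /eqP.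
  have [w wE [u xw]] := E2P r x Cr bad.
  by case: (avoidE v x t w u av t0 xE (inE2 r w wE) xw).
Qed.

(** * Divisibility by all the quadrics, and uniqueness *)

Lemma quadric_prime i j d (U U' : {mpoly K[4]}) : i != j -> U \is d.-homog ->
  U * Q j = U' * Q i -> exists U'', U = U'' * Q i.
Proof.
move=> ij hU UE.
(* A generic point of an edge lies on its two quadrics only; the edge is chosen on quadric [i] but
   not on quadric [j]. *)
have [x0 [x00 Qi Qj]] : exists x0 : 'rV[K]_4,
    [/\ x0 != 0, (Q i).@[x0 0] = 0 & (Q j).@[x0 0] != 0].
  have [jS|jS] := eqVneq j (ordS i).
    have [s [_ _ _ Qs]] := generic_edge_param (ord_pred i) (oner_neq0 _).
    exists (pt (ord_pred i) s); split; first exact: conic_pt_neq0.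
      by have [_] := conic_quadrics (ord_pred i) s; rewrite ord_predK.
    by apply: Qs; rewrite jS ?ord_predK ?ordS_pred_neq ?ordS_neq.
  have [s [_ _ _ Qs]] := generic_edge_param i (oner_neq0 _).
  exists (pt i s); split; first exact: conic_pt_neq0.
    by have [] := conic_quadrics i s.
  by apply: Qs => //; rewrite eq_sym.
have [y0 [a [b fr]]] := quadric_frame_exists (norm_quadric_nonsingular hS i) x00 Qi.
apply: (chart_dvd (hQ i) fr hU).
have [_ top] := chart_poly_top (Q i) x0 y0 a b (hQ j).
pose ch := chart_poly (Q i) x0 y0 a b; rewrite -/ch in top *.
have chM p p' : ch (p * p') = ch p * ch p' by rewrite /ch /chart_poly rmorphM.
have chi0 : ch (Q i) = 0.
  by apply: horner2_eq0 => s t; rewrite /ch chart_polyE // (chart_quadric (hQ i) fr).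
have chj0 : ch (Q j) != 0.
  apply: contraNneq Qj => chj; move: top; rewrite chj coef0 => /esym/eqP.
  by rewrite polyC_eq0 -scaleN1r (quadZ (hQ j)) sqrrN expr1n mul1r.
(* In the chart of quadric [i] the factor [Q i] becomes 0 while [Q j] does not, so [U] must become
   0. *)
by have /eqP := congr1 ch UE; rewrite !chM chi0 mulr0 mulf_eq0 (negPf chj0) orbF => /eqP.
Qed.

Lemma quadric_prime_prod i d (U : {mpoly K[4]}) rs : i \notin rs -> U \is d.-homog ->
    (exists U', U * \prod_(j <- rs) Q j = U' * Q i) ->
  exists U'', U = U'' * Q i.
Proof.
elim: rs d U => [|j rs IH] d U irs hU [U' UE].
  by exists U'; rewrite -UE big_nil mulr1.
move: irs; rewrite inE negb_or => /andP[ij irs].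
have [|U2 U2E] := IH (d + 2)%N (U * Q j) irs (dhomogM hU (hQ j)).
  by exists U'; rewrite -UE big_cons mulrA.
exact: quadric_prime ij hU U2E.
Qed.

(** The quadrics are pairwise distinct primes, so their product, of degree [2 * k], would divide
    [W]. *)
Lemma all_quadrics_dvd d (W : {mpoly K[4]}) : (d < 2 * k)%N -> W \is d.-homog ->
  (forall i, exists U, W = U * Q i) -> W = 0.
Proof.
move=> dk hW WQ; apply/eqP/negPn/negP => W0.
have hprod rs : \prod_(j <- rs) Q j \is (2 * size rs).-homog.
  elim: rs => [|j rs IH]; first by rewrite big_nil muln0 dhomog1.
  by rewrite big_cons mulnS dhomogM.
have [U WE] : exists U, W = U * \prod_(j <- enum 'I_k) Q j.
  elim: (enum 'I_k) (enum_uniq 'I_k) => [_|i rs IH /= /andP[irs urs]].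
    by exists W; rewrite big_nil mulr1.
  have [U WE] := IH urs.
  have [_ hU] : (2 * size rs <= d)%N /\ U \is (d - 2 * size rs).-homog.
    by apply: (@dhomog_factor _ _ _ _ U (\prod_(j <- rs) Q j)); rewrite -?WE.
  have [|U' UE] := quadric_prime_prod irs hU; first by rewrite -WE; apply: WQ.
  by exists U'; rewrite big_cons mulrA -UE.
have [] := @dhomog_factor _ _ d (2 * size (enum 'I_k)) U (\prod_(j <- enum 'I_k) Q j).
- by rewrite -WE.
- by rewrite -WE.
- exact: hprod.
by rewrite size_enum_ord leqNgt dk.
Qed.

Lemma adjoint_unique (A B : {mpoly K[4]}) :
    adjoint_surface S C A -> adjoint_surface S C B ->
  exists2 t : K, t != 0 & B = t *: A.
Proof.
move=> [[A0 hA] resA CA] [[B0 hB] resB CB].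
have /choice[al /choice[UA AE]] i := adjoint_mod_quadric i hA resA.
have /choice[be /choice[UB BE]] i := adjoint_mod_quadric i hB resB.
have evalE (X : {mpoly K[4]}) s U i (w : 'rV[K]_4) : X - s *: F i = U * Q i -> (Q i).@[w 0] = 0 ->
    X.@[w 0] = s * (F i).@[w 0].
  move=> XE Qw; have := congr1 (meval (w 0)) XE.
  by rewrite mevalB mevalZ mevalM Qw mulr0 => /eqP; rewrite subr_eq0 => /eqP.
(* Otherwise [A] vanishes on quadric [i], hence on the edge it contains. *)
have al0 i : al i != 0.
  apply/eqP => ali; apply: (CA i) => x Cx.
  have Qx : (Q i).@[hvec x 0] = 0 by apply/(zeros_norm); apply: (edge_sub hS Cx).
  by rewrite /zeros /= -[hcoord x]/(hvec x 0) (evalE _ _ _ _ _ (AE i) Qx) ali mul0r.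
pose i0 : 'I_k := Ordinal (leq_trans (isT : 0 < 3)%N hk).
pose t := be i0 / al i0.
(* At a generic point of the edge common to quadrics [i] and [ordS i], both residual products are
   nonzero and compute the same values of [A] and [B]. *)
have ratio : forall i, be i = t * al i.
  apply: (@ordS_cycle_ind k (fun i => be i = t * al i) i0); first by rewrite divfK.
  move=> i bi; have [s [s0 _ ms Qs]] := generic_edge_param i (oner_neq0 _).
  have [Fs FSs] := residual_form_nonzero_edge s0 ms Qs.
  have [Qi QSi] := conic_quadrics i s.
  apply: (mulIf FSs); rewrite -(evalE _ _ _ _ _ (BE (ordS i)) QSi) (evalE _ _ _ _ _ (BE i) Qi) bi.
  by rewrite -mulrA -(evalE _ _ _ _ _ (AE i) Qi) (evalE _ _ _ _ _ (AE (ordS i)) QSi) mulrA.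
have BA : B - t *: A = 0.
  apply: (@all_quadrics_dvd N); first by move: hk; lia.
    by rewrite rpredB // rpredZ.
  move=> i; exists (UB i - t *: UA i); rewrite mulrBl -scalerAl -BE -AE ratio.
  by rewrite scalerBr scalerA opprB addrA subrK.
exists t; last by apply/eqP; rewrite -subr_eq0 BA.
by apply: contraNneq B0 => t0; rewrite -[B](subrK (t *: A)) BA t0 scale0r addr0.
Qed.

(** * Construction of the adjoint *)

Definition edge_coprod i := \prod_(j | (j != i) && (j != ordS i)) Q j.
Local Notation P := edge_coprod.

Lemma edge_coprod_homog i : P i \is (2 * k - 4).-homog.
Proof.
have -> : (2 * k - 4 = \sum_(j | (j != i) && (j != ordS i)) 2)%N.
  have : (\sum_(j < k) 2 = 2 * k)%N by rewrite sum_nat_const card_ord mulnC.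
  by rewrite (bigD1 i) //= (bigD1 (ordS i)) ?ordS_neq //= => <-; lia.
by apply: dhomog_bigprod => j _; apply: hQ.
Qed.

(** Since [m i * l i] is [Q (ordS i) - Q i], each term is the product omitting [i] minus the product
    omitting [ordS i]. *)
Lemma telescope : \sum_i m i * l i * P i = 0.
Proof.
have term i : m i * l i * P i = \prod_(j | j != i) Q j - \prod_(j | j != ordS i) Q j.
  rewrite [\prod_(j | j != i) _](bigD1 (ordS i)) ?ordS_neq //=.
  rewrite [\prod_(j | j != ordS i) _](bigD1 i) 1?eq_sym ?ordS_neq //=.
  have -> : \prod_(j | (j != ordS i) && (j != i)) Q j = P i.
    by apply: eq_bigl => j; rewrite andbC.
  by rewrite -/(P i) QS -mulrBl addrAC subrr add0r.
rewrite (eq_bigr _ (fun i _ => term i)) sumrB.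
rewrite [X in _ - X](_ : _ = \sum_i \prod_(j | j != i) Q j) ?subrr //.
by rewrite [RHS](reindex_inj (@ordS_inj k)).
Qed.

(** Unless [P r] vanishes, [i] and [j] are [r] and [ordS r]. Then [m r * l r] vanishes, and [l r]
    cannot, as its zeros on the quadric lie on the edge. *)
Lemma edge_coprod_residual r i j x : i != j -> ~ (exists n, C n x) ->
    (Q i).@[hvec x 0] = 0 -> (Q j).@[hvec x 0] = 0 -> (m r * P r).@[hvec x 0] = 0.
Proof.
move=> ij noC Qi Qj; rewrite mevalM.
have [P0|P0] := eqVneq (P r).@[hvec x 0] 0; first by rewrite P0 mulr0.
have inr n : (Q n).@[hvec x 0] = 0 -> (n == r) || (n == ordS r).
  move=> Qn; apply: contraNT P0; rewrite negb_or => nr; rewrite /P rmorph_prod.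
  by apply/eqP/eqP/prodf_eq0; exists n => //; apply/eqP.
have [Qr QSr] : (Q r).@[hvec x 0] = 0 /\ (Q (ordS r)).@[hvec x 0] = 0.
  case/orP: (inr i Qi) => /eqP Ei; case/orP: (inr j Qj) => /eqP Ej.
  - by rewrite Ei Ej eqxx in ij.
  - by rewrite -Ej -Ei.
  - by rewrite -Ei -Ej.
  - by rewrite Ei Ej eqxx in ij.
have := QSr; rewrite QS mevalD mevalM Qr add0r => /eqP; rewrite mulf_eq0.
case/orP=> /eqP; first by move=> ->; rewrite mul0r.
by move=> lx; case: noC; exists r; apply: (plane_conic).
Qed.

(** For [r != i] the product [P r] has [Q i] or [Q (ordS i)] as a factor, and both vanish on edge
    [i]. *)
Lemma edge_coprod_other i r s : r != i -> (P r).@[pt i s 0] = 0.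
Proof.
have [Qi QSi] := conic_quadrics i s.
move=> ri; rewrite /P rmorph_prod; apply/eqP/prodf_eq0.
have [ir|ir] := eqVneq i (ordS r); last first.
  by exists i; [rewrite [i == r]eq_sym ri ir | rewrite /= Qi].
exists (ordS i); last by rewrite /= QSi.
by rewrite ir (inj_eq (@ordS_inj k)) ordS_neq // ordSS_neq.
Qed.

Lemma adjoint_exists : exists A : {mpoly K[4]},
  [/\ A \is N.-homog, (residual S C `<=` zeros A)%classic &
      forall i, ~ (C i `<=` zeros A)%classic].
Proof.
have f12 : free [:: a1; a2] := free_hvec (cq_poles_distinct hS).
have [b3 /= f3] := free_extend f12 isT; have [b4 /= f4] := free_extend f3 isT.
(* [z] and [w] span the forms vanishing at both poles, among them all the [l i]. *)
have [z hz zE] := @dual_form K 4 [tuple a1; a2; b3; b4] (Ordinal (isT : 2 < 4)%N) f4.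
have [w hw wE] := @dual_form K 4 [tuple a1; a2; b3; b4] (Ordinal (isT : 3 < 4)%N) f4.
have [z1 z2 z3 z4] : [/\ z.@[a1 0] = 0, z.@[a2 0] = 0, z.@[b3 0] = 1 & z.@[b4 0] = 0].
  by split; [exact: (zE (Ordinal (isT : 0 < 4)%N)) | exact: (zE (Ordinal (isT : 1 < 4)%N))
    | exact: (zE (Ordinal (isT : 2 < 4)%N)) | exact: (zE (Ordinal (isT : 3 < 4)%N))].
have [w1 w2 w3 w4] : [/\ w.@[a1 0] = 0, w.@[a2 0] = 0, w.@[b3 0] = 0 & w.@[b4 0] = 1].
  by split; [exact: (wE (Ordinal (isT : 0 < 4)%N)) | exact: (wE (Ordinal (isT : 1 < 4)%N))
    | exact: (wE (Ordinal (isT : 2 < 4)%N)) | exact: (wE (Ordinal (isT : 3 < 4)%N))].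
have comb4 (p : {mpoly K[4]}) (s t u v : K) : p \is 1.-homog ->
    p.@[(s *: a1 + t *: a2 + u *: b3 + v *: b4) 0] =
    s * p.@[a1 0] + t * p.@[a2 0] + u * p.@[b3 0] + v * p.@[b4 0].
  by move=> hp; rewrite -[X in X + _]scale1r linear_eval2 // linear_eval3 // mul1r.
pose ls i := (l i).@[b3 0]; pose lt i := (l i).@[b4 0].
have lE i : l i = ls i *: z + lt i *: w.
  apply/eqP; rewrite -subr_eq0; apply/negPn/negP => /mpoly_vector_nonroot[y].
  have [s [t [u [v ->]]]] := free4_span y f4; have [_ [l1 l2 _ _] _ _ _] := cf i.
  rewrite mevalB mevalD !mevalZ !comb4 // l1 l2 z1 z2 z3 z4 w1 w2 w3 w4 => /eqP; apply.
  rewrite /ls /lt; ring.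
pose X := \sum_i ls i *: (m i * P i); pose Y := \sum_i lt i *: (m i * P i).
have XY : z * X + w * Y = 0.
  rewrite -telescope !mulr_sumr -big_split; apply: eq_bigr => i _ /=.
  by rewrite (lE i) !scalerAr -!mul_mpolyC; ring.
have w0 : w != 0.
  by apply/eqP => w0; move: w4; rewrite w0 meval0 => /esym/eqP; rewrite oner_eq0.
have z0 : z != 0.
  by apply/eqP => z0; move: z3; rewrite z0 meval0 => /esym/eqP; rewrite oner_eq0.
have [z_lin _] := linear_form hz; have [w_lin _] := linear_form hw.
(* On [z = 0] the relation gives [w * Y = 0], and [w] is constant along [b3]; hence [z] divides
   [Y]. *)
have [x s wx zx|A YE] := @linear_dvd _ _ z Y b3 w hz z3 w0.
  have wxs : w.@[(x + s *: b3) 0] != 0 by rewrite addrC w_lin w3 mulr0 add0r.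
  apply: (mulfI wxs); rewrite mulr0.
  have := congr1 (meval ((x + s *: b3) 0)) XY.
  by rewrite mevalD !mevalM zx mul0r add0r meval0.
have XE : X = - (A * w).
  apply: (mulfI z0); apply/eqP; rewrite mulrN -addr_eq0 -XY YE.
  by apply/eqP; ring.
have hA : A \is N.-homog.
  apply: (dhomog_mulr z0 hz); rewrite mulrC -YE; apply: rpred_sum => i _; rewrite rpredZ //.
  by apply: dhomogM => //; apply: edge_coprod_homog.
exists A; split=> //.
- move=> x [[i [j [ij Si Sj]]] noC].
  have Qi := (zeros_norm i x).1 Si; have Qj := (zeros_norm j x).1 Sj.
  have X0 : X.@[hvec x 0] = 0.
    rewrite raddf_sum big1 // => r _.
    by rewrite /= mevalZ (edge_coprod_residual r ij noC Qi Qj) mulr0.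
  have Y0 : Y.@[hvec x 0] = 0.
    rewrite raddf_sum big1 // => r _.
    by rewrite /= mevalZ (edge_coprod_residual r ij noC Qi Qj) mulr0.
  (* If [A] were nonzero, [X = - (A * w)] and [Y = A * z] would put the point on the line of the
     poles, so on every edge plane. *)
  apply: contrapT => /eqP Ax; have [xz xw] : z.@[hvec x 0] = 0 /\ w.@[hvec x 0] = 0.
    split; apply: (mulfI Ax); rewrite mulr0 -mevalM; first by rewrite -YE Y0.
    by apply/eqP; rewrite -oppr_eq0 -mevalN -XE X0.
  apply: noC; exists i; apply: (plane_conic) => //.
  by rewrite lE mevalD !mevalZ xz xw !mulr0 addr0.
move=> i CA; have [s [s0 _ ms Qs]] := generic_edge_param i (oner_neq0 _).
have [x [t t0 xE]] := point_of (conic_pt_neq0 (fe i) (c0 i) s).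
have Apt : A.@[pt i s 0] = 0.
  by apply/(zeros_scale hA t0 xE)/CA/(conic_pt_mem t0 xE).
have mPi : (m i * P i).@[pt i s 0] != 0.
  rewrite mevalM mulf_neq0 //; first by rewrite -conic_polyE.
  by rewrite rmorph_prod; apply/prodf_neq0 => j /andP[ji jS]; apply: Qs.
(* On edge [i] only the term of index [i] survives, so [A] vanishing there would force both
   coefficients of [l i] to be zero. *)
have single (f : 'I_k -> K) :
    (\sum_r f r *: (m r * P r)).@[pt i s 0] = f i * (m i * P i).@[pt i s 0].
  rewrite raddf_sum (bigD1 i) //= big1 ?addr0 ?mevalZ // => r ri.
  by rewrite mevalZ mevalM edge_coprod_other // !mulr0.
have li0 : l i = 0.
  have := single lt; rewrite -/Y YE mevalM Apt mul0r => /esym/eqP.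
  have := single ls; rewrite -/X XE mevalN mevalM Apt mul0r oppr0 => /esym/eqP.
  rewrite !mulf_eq0 (negPf mPi) !orbF => /eqP ls0 /eqP lt0.
  by rewrite lE ls0 lt0 !scale0r addr0.
by have [[/eqP]] := cf i.
Qed.

(** Modulo [Q i], [A] is a multiple of [residual_prod i], which for [k] above 3 contains a whole
    quadric as a factor. *)
Lemma adjoint_through_poles (A : {mpoly K[4]}) : (3 < k)%N ->
    A \is N.-homog -> (residual S C `<=` zeros A)%classic ->
  zeros A v1 /\ zeros A v2.
Proof.
move=> k4 hA resA; pose i : 'I_k := Ordinal (leq_trans (isT : 0 < 3)%N hk).
have [al [U AE]] := adjoint_mod_quadric i hA resA.
have [j [ji jS jp]] : exists j, [/\ j != i, j != ordS i & j != ord_pred i].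
  (* Two steps ahead of [i], which is its predecessor exactly when [k] is 3. *)
  exists (ordS (ordS i)); split; first exact: ordSS_neq.
    exact: ordS_neq.
  rewrite -(inj_eq (@ordS_inj k)) ord_predK -val_eqE /=.
  by rewrite !modn_small //; move: k4; lia.
suff vanish x : (x = v1 \/ x = v2) -> zeros A x by split; apply: vanish; [left|right].
move=> xv; have Qx n : (Q n).@[hvec x 0] = 0.
  apply/(zeros_norm); exact: (cq_common hS xv).
have := congr1 (meval (hvec x 0)) AE; rewrite mevalB mevalZ mevalM Qx mulr0.
have -> : (residual_prod i).@[hvec x 0] = 0.
  rewrite rmorph_prod; apply/eqP/prodf_eq0; exists j => //.
  by rewrite /residual_form (negPf jS) (negPf jp) /= Qx.
by rewrite mulr0 subr0.
Qed.

End Cycle.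

Theorem theorem6p8 (R : realType) (k : nat) (hk : (3 <= k)%N)
    (S : 'I_k -> {mpoly R[i][4]}) (C : 'I_k -> set (P3 R[i]))
    (v1 v2 : P3 R[i]) (hS : cycle_of_quadrics S C v1 v2) :
  exists A : {mpoly R[i][4]},
    [/\ adjoint_surface S C A,
        forall B, adjoint_surface S C B -> exists2 c : R[i], c != 0 & B = c *: A &
        (3 < k)%N -> zeros A v1 /\ zeros A v2].
Proof.
have [l [e [c cf]]] := cycle_frames hS; have [m mP] := cycle_residual_planes hS cf.
have [A [hA resA CA]] := adjoint_exists hk hS cf mP.
have adjA : adjoint_surface S C A.
  split=> //; split=> //; apply/eqP => A0.
  by apply: (CA (Ordinal (leq_trans (isT : 0 < 3)%N hk))) => x _; rewrite A0 /zeros /= meval0.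
exists A; split=> // [B adjB | k4]; first exact: (adjoint_unique hk hS cf mP).
exact: (adjoint_through_poles hk hS cf mP).
Qed.
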